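(* Let $G=(V,E)$ be a finite colored graph, let $V_i$ denote the set of nodes of color $i$, and suppose that for every color $i$ the induced subgraph $G[V_i]$ has at most $q$ connected components. Then (a) for any pair of distinct non-adjacent nodes $s,t$, the value of the minimum color $st$ node cut of $G$ can be approximated within factor $q$ in $O(|V|^{0.5}|E|+|V|^2)$ time, and (b) the value of the global minimum color node cut of $G$ can be approximated within factor $q$ in $O(|V|^{2.5}|E|)$ time. If $q=1$, these computations give the exact values.
   Context: A colored graph is a finite undirected graph in which each node carries exactly one color. A node cut of $G$ is a set $X\subseteq V$ such that removing $X$ either leaves a graph with more than one connected component or leaves exactly one node. A color node cut is a set $C_c$ of colors such that the set of nodes whose color lies in $C_c$ contains a node cut; the value of the global minimum color node cut is the minimum size of a color node cut. For distinct non-adjacent $s,t$, an $st$ node cut is a set $X\subseteq V\setminus\{s,t\}$ whose removal separates $s$ from $t$; a color $st$ node cut is a set of colors such that the nodes with those colors (possibly including $s$, $t$) contain an $st$ node cut; its minimum size is the value of the minimum color $st$ node cut. ''Approximated within factor $q$'' means an algorithm outputs a number $A$ with $c\le A\le qc$, where $c$ is the true value. *)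

(* Defs.v *)
From HB Require Import structures.
From mathcomp Require Import all_boot all_order all_algebra.

Set Implicit Arguments.
Unset Strict Implicit.
Unset Printing Implicit Defensive.

Record colored_graph (V C : finType) := ColoredGraph {
  adj : rel V;
  adj_sym : symmetric adj;
  adj_irr : irreflexive adj;
  color : V -> C
}.

Section ColoredGraphs.
Variables (V C : finType) (G : colored_graph V C).
Implicit Types (A X : {set V}) (S : {set C}) (s t : V).

Definition edges : {set {set V}} :=
  [set [set p.1; p.2] | p : V * V & adj G p.1 p.2].

Definition induced A : rel V :=
  [rel u v | [&& u \in A, v \in A & adj G u v]].

(* Vertices outside [A] are isolated for [induced A], so restricting [n_comp]
   to [A] counts exactly the connected components of G[A]. *)
Definition num_components A : nat := n_comp (induced A) A.

Definition nodes_colored S : {set V} := [set v | color G v \in S].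

Definition node_cut X : bool :=
  (1 < num_components (~: X)) || (#|~: X| == 1).

Definition color_node_cut S : bool :=
  [exists X : {set V}, (X \subset nodes_colored S) && node_cut X].

Definition st_node_cut s t X : bool :=
  (X \subset ~: [set s; t]) && ~~ connect (induced (~: X)) s t.

(* [S] may contain the colors of [s] and [t], which are never removed. *)
Definition color_st_node_cut s t S : bool :=
  [exists X : {set V}, (X \subset nodes_colored S) && st_node_cut s t X].

Definition is_min_size (P : pred {set C}) (c : nat) : Prop :=
  (exists2 S, P S & #|S| = c) /\ (forall S, P S -> c <= #|S|).

(* An edge list of the graph: every edge occurs exactly once, in an arbitrary
   position and with an arbitrary orientation. *)
Definition edge_list (es : seq (V * V)) : Prop :=
  perm_eq [seq [set p.1; p.2] | p <- es] (enum edges).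

(* |V|, |E|, the colors of the nodes, then the two end points of each edge;
   nodes and colors are numbered from 0. *)
Definition graph_input (es : seq (V * V)) : seq nat :=
  [:: #|V|; size es]
    ++ [seq (enum_rank (color G v) : nat) | v <- enum V]
    ++ flatten [seq [:: (enum_rank p.1 : nat); (enum_rank p.2 : nat)] | p <- es].

Definition st_graph_input s t (es : seq (V * V)) : seq nat :=
  [:: (enum_rank s : nat); (enum_rank t : nat)] ++ graph_input es.

End ColoredGraphs.

Definition within_factor (q c a : nat) : Prop := c <= a <= q * c.

(* Algorithms are programs of a unit-cost random access machine whose only
   arithmetic operations are addition and truncated subtraction (as in Cook and
   Reckhow's RAM; there is no multiplication, which at unit cost would be
   unrealistically powerful). The memory is divided into arrays; a program names
   finitely many of them, by constants, while the indices within an array are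
   computed. *)
Definition memory := nat -> nat -> nat.

Inductive expr :=
  | Const of nat
  | Read of nat & expr
  | Add of expr & expr
  | Sub of expr & expr.

Inductive prog :=
  | Skip
  | Write of nat & expr & expr
  | Seq of prog & prog
  | If of expr & prog & prog
  | While of expr & prog.

Fixpoint eval (m : memory) (e : expr) : nat :=
  match e with
  | Const k => k
  | Read a i => m a (eval m i)
  | Add e1 e2 => eval m e1 + eval m e2
  | Sub e1 e2 => eval m e1 - eval m e2
  end.

Fixpoint expr_cost (e : expr) : nat :=
  match e with
  | Const _ => 1
  | Read _ i => (expr_cost i).+1
  | Add e1 e2 | Sub e1 e2 => (expr_cost e1 + expr_cost e2).+1
  end.

Definition update (m : memory) (a i x : nat) : memory :=
  fun b j => if (b == a) && (j == i) then x else m b j.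

(* [exec p m T m']: started in memory [m], the program [p] halts in memory [m']
   after [T] elementary operations. Tests succeed on nonzero values, so that
   [Sub e2 e1] tests e1 < e2. *)
Inductive exec : prog -> memory -> nat -> memory -> Prop :=
  | ExecSkip m : exec Skip m 1 m
  | ExecWrite m a i e :
      exec (Write a i e) m (expr_cost i + expr_cost e).+1
           (update m a (eval m i) (eval m e))
  | ExecSeq m m1 m2 p1 p2 T1 T2 :
      exec p1 m T1 m1 -> exec p2 m1 T2 m2 -> exec (Seq p1 p2) m (T1 + T2) m2
  | ExecIfTrue m m1 e p1 p2 T :
      eval m e != 0 -> exec p1 m T m1 ->
      exec (If e p1 p2) m (expr_cost e + T).+1 m1
  | ExecIfFalse m m1 e p1 p2 T :
      eval m e = 0 -> exec p2 m T m1 ->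
      exec (If e p1 p2) m (expr_cost e + T).+1 m1
  | ExecWhileTrue m m1 m2 e p T1 T2 :
      eval m e != 0 -> exec p m T1 m1 -> exec (While e p) m1 T2 m2 ->
      exec (While e p) m (expr_cost e + T1 + T2).+1 m2
  | ExecWhileFalse m e p :
      eval m e = 0 -> exec (While e p) m (expr_cost e).+1 m.

(* Array 0 holds the input and every other cell is 0. *)
Definition initial_memory (inp : seq nat) : memory :=
  fun a i => if a == 0 then nth 0 inp i else 0.

(* The result is read in cell 0 of array 1. *)
Definition outputs_in_time (p : prog) (inp : seq nat) (a T : nat) : Prop :=
  exists2 m, exec p (initial_memory inp) T m & m 1 0 = a.

(* Main.v *)
(* Replace each color class by its components: a minimum set of components (minus
   [s] and [t]) separating [s] from [t] has size between [c] and [q * c], because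
   a set of components uses at most as many colors, and a color has at most [q]
   components. With one left and one right vertex per component, Konig's theorem
   turns this number into the size of a maximum bipartite matching minus the
   number of nodes.

   The matching is found in O(sqrt |V|) linear passes. First, unmatched left
   vertices bid for a neighbor of least price, which they outbid by one, until
   all their neighbors cost L = ceil (sqrt (2 |V|)). For every threshold
   [1 <= i <= L], the right vertices of price at least [i] and the left vertices
   with a neighbor cheaper than [i] then form a vertex cover, which exceeds the
   matching by at most the number of right vertices of price exactly [i]; for the
   best [i] this is at most L, so at most L augmenting paths are missing. The
   components are computed by relabelling, in O(|V|^2 + |E|).

   For global cuts, take the minimum over nonadjacent pairs [s, t] and over the
   number of components meeting [V \ {v}]. A graph with 2|E| < |V| has an
   isolated node and is treated in constant time; otherwise |V| = O(|E|). *)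

Require Import Defs.
From HB Require Import structures.
From mathcomp Require Import all_boot all_order all_algebra.
From mathcomp Require Import zify lra.
From Stdlib Require Import FunctionalExtensionality.

Set Implicit Arguments.
Unset Strict Implicit.
Unset Printing Implicit Defensive.

(** * Budgeted execution of programs *)

(** The square root comes from a balance. Raising all levels up to L costs L scans of all lists,
    while the smallest of L price classes holds at most 2|V| / L right vertices. With L^2 >= 2|V| at
    most L augmentations remain, so both stages cost O(L (|V| + |E|)). The gap is certified by a
    vertex cover and weak duality alone; no lengths of augmenting paths are compared.

    The number of nodes is subtracted because every number a in 1..|V|, label or not, carries an
    edge joining its left and its right vertex. A cover pays at least once for each a, and the
    labels for which it pays again form the cut.

    Relabelling costs |V| per merge, and each merge removes a label, whence the term |V|^2.

    Only loop iterations are counted. The text of the program supplies the constant factor, and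
    every loop is paid for by a potential that its iterations lower. *)

Fixpoint psize (p : prog) : nat :=
  match p with
  | Skip => 1
  | Write _ i e => (expr_cost i + expr_cost e).+1
  | Seq p1 p2 => psize p1 + psize p2
  | If e p1 p2 => (expr_cost e + psize p1 + psize p2).+1
  | While e p => (expr_cost e + psize p).+1
  end.

(* The budget [k] only counts iterations of loops: between two of them a program
   runs for at most [psize p] elementary operations. *)
Definition wp (p : prog) (m : memory) (k : nat) (Q : memory -> Prop) : Prop :=
  exists T m', [/\ exec p m T m', T <= psize p * k.+1 & Q m'].

Fixpoint writes (p : prog) : seq nat :=
  match p with
  | Skip => [::]
  | Write a _ _ => [:: a]
  | Seq p1 p2 | If _ p1 p2 => writes p1 ++ writes p2
  | While _ p => writes p
  end.

Definition upd (f : nat -> nat) (i x : nat) : nat -> nat :=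
  fun j => if j == i then x else f j.

Arguments update : simpl never.
Arguments upd : simpl never.

Lemma updateE m a i x b :
  update m a i x b = if b == a then upd (m a) i x else m b.
Proof.
by rewrite /update /upd; case: eqP => [->|_]; apply: functional_extensionality.
Qed.

Lemma updE f i x j : upd f i x j = if j == i then x else f j.
Proof. by []. Qed.

Lemma upd_same f i x : upd f i x i = x.
Proof. by rewrite updE eqxx. Qed.

Lemma upd_other f i x j : j != i -> upd f i x j = f j.
Proof. by rewrite updE => /negPf ->. Qed.

Lemma exec_frame p m T m' a : exec p m T m' -> a \notin writes p -> m' a = m a.
Proof.
elim=> {p m T m'} //=.
- by move=> m b i e; rewrite inE updateE => /negbTE ->.
- move=> m m1 m2 p1 p2 T1 T2 _ IH1 _ IH2.
  by rewrite mem_cat negb_or => /andP[/IH1 <- /IH2 ->].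
- by move=> m m1 e p1 p2 T _ _ IH; rewrite mem_cat negb_or => /andP[/IH].
- by move=> m m1 e p1 p2 T _ _ IH; rewrite mem_cat negb_or => /andP[_ /IH].
- by move=> m m1 m2 e p T1 T2 _ _ IH1 _ IH2 na; rewrite IH2 // IH1.
Qed.

Lemma wp_weaken p m k1 k2 (Q1 Q2 : memory -> Prop) :
  wp p m k1 Q1 -> k1 <= k2 -> (forall m', Q1 m' -> Q2 m') -> wp p m k2 Q2.
Proof.
move=> [T [m' [E L Q]]] le12 Q12; exists T, m'; split=> //; last exact: Q12.
by apply: leq_trans L _; rewrite leq_mul2l ltnS le12 orbT.
Qed.

Lemma wp_frame p m k (Q : memory -> Prop) :
  wp p m k Q ->
  wp p m k (fun m' => Q m' /\ forall a, a \notin writes p -> m' a = m a).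
Proof.
move=> [T [m' [E L HQ]]]; exists T, m'; split=> //; split=> // a.
exact: exec_frame E.
Qed.

(** The [.+1] in [wp] covers one straight run through the text. Budgets add without loss because the
    size of a sequence is the sum of the sizes, so both parts share that extra unit. *)
Lemma wp_seq p1 p2 m k1 k2 (Q : memory -> Prop) :
  wp p1 m k1 (fun m' => wp p2 m' k2 Q) -> wp (Seq p1 p2) m (k1 + k2) Q.
Proof.
move=> [T1 [m1 [E1 L1 [T2 [m2 [E2 L2 HQ]]]]]].
exists (T1 + T2), m2; split=> //; first exact: ExecSeq E1 E2.
by rewrite /=; nia.
Qed.

Lemma wp_skip m k (Q : memory -> Prop) : Q m -> wp Skip m k Q.
Proof. by move=> Qm; exists 1, m; split=> //; constructor. Qed.

Lemma wp_write a i e m k (Q : memory -> Prop) :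
  Q (update m a (eval m i) (eval m e)) -> wp (Write a i e) m k Q.
Proof.
move=> Qm; eexists; eexists; split; [exact: ExecWrite| |exact: Qm].
by rewrite /=; nia.
Qed.

Lemma wp_seq_write a i e p m k (Q : memory -> Prop) :
  wp p (update m a (eval m i) (eval m e)) k Q -> wp (Seq (Write a i e) p) m k Q.
Proof. by move=> w; rewrite -[k]add0n; apply/wp_seq/wp_write. Qed.

Lemma wp_if e p1 p2 m k (Q : memory -> Prop) :
  (eval m e != 0 -> wp p1 m k Q) -> (eval m e = 0 -> wp p2 m k Q) ->
  wp (If e p1 p2) m k Q.
Proof.
move=> w1 w2; have [e0|e0] := eqVneq (eval m e) 0.
  have [T [m' [E L HQ]]] := w2 e0.
  exists (expr_cost e + T).+1, m'; split=> //; first exact: ExecIfFalse.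
  by rewrite /=; nia.
have [T [m' [E L HQ]]] := w1 e0.
exists (expr_cost e + T).+1, m'; split=> //; first exact: ExecIfTrue.
by rewrite /=; nia.
Qed.

(** An iteration may spend an inner budget [j] if it lowers the potential by at least [j + 1]: the
    additional unit pays for the test and for one straight run of the body. *)
Lemma wp_while e p (I : memory -> Prop) (pot : memory -> nat) m k
    (Q : memory -> Prop) :
  I m -> pot m <= k ->
  (forall m1, I m1 -> eval m1 e != 0 ->
     exists2 j, j < pot m1 &
       wp p m1 j (fun m2 => I m2 /\ j + pot m2 < pot m1)) ->
  (forall m1, I m1 -> eval m1 e = 0 -> Q m1) ->
  wp (While e p) m k Q.
Proof.
move=> Im le_k step fin.
apply: (@wp_weaken _ _ (pot m) _ Q) => // {k le_k}.
have [b] := ubnP (pot m); elim: b m Im => // b IH m Im ltb.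
have [e0|e0] := eqVneq (eval m e) 0.
  exists (expr_cost e).+1, m; split; [exact: ExecWhileFalse| |exact: fin].
  by rewrite /=; nia.
have [j ltj [T1 [m1 [E1 L1 [I1 lt1]]]]] := step m Im e0.
have [|T2 [m2 [E2 L2 Q2]]] := IH m1 I1; first by lia.
exists (expr_cost e + T1 + T2).+1, m2; split=> //.
  exact: ExecWhileTrue E1 E2.
rewrite /= in L2 *; set s := _.+1 in L2 *.
have: psize p * j.+1 + (expr_cost e).+1 <= s * j.+1 by rewrite /s; nia.
have: s * (j.+1 + (pot m1).+1) <= s * (pot m).+1 by rewrite leq_mul2l; lia.
rewrite mulnDr; lia.
Qed.

Lemma wp_while_frame e p (I : memory -> Prop) (pot : memory -> nat) m k
    (Q : memory -> Prop) :
  I m -> pot m <= k ->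
  (forall m1 : memory, (forall a, a \notin writes p -> m1 a = m a) ->
     I m1 -> eval m1 e != 0 ->
     exists2 j, j < pot m1 &
       wp p m1 j (fun m2 => I m2 /\ j + pot m2 < pot m1)) ->
  (forall m1 : memory, (forall a, a \notin writes p -> m1 a = m a) ->
     I m1 -> eval m1 e = 0 -> Q m1) ->
  wp (While e p) m k Q.
Proof.
move=> Im le_k step fin.
pose J m1 := I m1 /\ forall a, a \notin writes p -> m1 a = m a.
apply: (@wp_while _ _ J pot) => //; last by move=> m1 [I1 fr1]; apply: fin.
move=> m1 [I1 fr1] e1; have [j ltj w] := step m1 fr1 I1 e1.
exists j => //; apply: (wp_weaken (wp_frame w)) => // m2 [[I2 lt2] fr2].
by split=> //; split=> // a na; rewrite fr2 // fr1.
Qed.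

(* A scalar variable is cell 0 of an array. *)
Definition Var (a : nat) : expr := Read a (Const 0).
Definition Assign (a : nat) (e : expr) : prog := Write a (Const 0) e.
Definition For (i h : nat) (p : prog) : prog :=
  Seq (Assign i (Const 0))
      (While (Defs.Sub (Var h) (Var i))
        (Seq p (Assign i (Add (Var i) (Const 1))))).
Definition Neq (e1 e2 : expr) : expr := Add (Defs.Sub e1 e2) (Defs.Sub e2 e1).

Lemma eval_Neq m e1 e2 : (eval m (Neq e1 e2) != 0) = (eval m e1 != eval m e2).
Proof. by rewrite /=; lia. Qed.

(** The invariant is indexed by the number of completed iterations and has to survive writes to the
    counter, which is incremented only after the body. *)
Lemma wp_for (i h : nat) p (I : nat -> memory -> Prop) m (j k H : nat)
    (Q : memory -> Prop) :
  i != h -> i \notin writes p -> h \notin writes p -> m h 0 = H ->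
  H * j.+1 <= k ->
  (forall x y m1, I x m1 -> I x (update m1 i 0 y)) ->
  I 0 m ->
  (forall x (m1 : memory), x < H -> m1 i 0 = x -> m1 h 0 = H ->
     (forall a, a \notin i :: writes p -> m1 a = m a) ->
     I x m1 -> wp p m1 j (I x.+1)) ->
  (forall m1 : memory, (forall a, a \notin i :: writes p -> m1 a = m a) ->
     I H m1 -> Q m1) ->
  wp (For i h p) m k Q.
Proof.
move=> nih ip hp mh lek Iupd I0 step fin.
apply: wp_seq_write => /=.
pose J (m1 : memory) := [/\ m1 i 0 <= H, m1 h 0 = H,
  (forall a, a \notin i :: writes p -> m1 a = m a) & I (m1 i 0) m1].
apply: (@wp_while _ _ J (fun m1 => (H - m1 i 0) * j.+1)).
- split; first by rewrite updateE eqxx updE.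
  + by rewrite updateE eq_sym (negPf nih).
  + by move=> a; rewrite inE negb_or updateE => /andP[/negPf ->].
  + by rewrite [update _ _ _ _ i]updateE eqxx; apply: Iupd.
- by rewrite updateE eqxx updE eqxx subn0.
- move=> m1 [le1 h1 fr1 I1] /= lt1; exists j; first by nia.
  rewrite -[X in wp _ _ X]addn0; apply: wp_seq.
  have := step (m1 i 0) m1 _ erefl h1 fr1 I1.
  rewrite -h1 => /(_ ltac:(lia)) /wp_frame w.
  apply: (wp_weaken w) => // m2 [I2 fr2].
  have e_i : m2 i = m1 i by exact: fr2.
  apply: wp_write => /=; rewrite e_i addn1; split; last first.
    by rewrite updateE eqxx updE eqxx; nia.
  split.
  + by rewrite updateE eqxx updE eqxx; lia.
  + by rewrite updateE eq_sym (negPf nih) fr2.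
  + move=> a; rewrite inE negb_or updateE => /andP[/negPf ni na].
    by rewrite ni fr2 // fr1 // inE ni.
  + by rewrite [update _ _ _ _ i]updateE eqxx updE eqxx; apply: Iupd.
- move=> m1 [le1 h1 fr1 I1] /= e0; apply: fin => //.
  suff <- : m1 i 0 = H by [].
  by lia.
Qed.

(* Evaluates a chain of updates by conversion, which is much faster than
   rewriting when the array names are numerals. *)
Ltac resolve t :=
  lazymatch t with
  | update ?m ?a ?i ?x ?a =>
    let f := resolve constr:(m a) in constr:(upd f i x)
  | update ?m ?a ?i ?x ?b => resolve constr:(m b)
  | _ => t
  end.
Ltac reads :=
  rewrite /=;
  repeat match goal with
  | |- context [update ?m ?a ?i ?x ?b] =>
    let t := constr:(update m a i x b) in
    let r := resolve t in change t with r
  end; rewrite ?upd_same /=.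
Ltac frames :=
  reads;
  repeat (match goal with
  | H : forall a, is_true (a \notin _) -> ?m1 a = _ |- context [?m1 ?a] =>
    rewrite (H a isT)
  end; reads).
Ltac step := apply: wp_seq_write; reads.
Ltac last_step := apply: wp_write; reads.

(** * Matchings and vertex covers *)

(** Bipartite vertices, labels and list edges are numbered from 1, so that 0 can mean that there is
    none; sums therefore start from 1. *)
Definition tsum (N : nat) (F : nat -> nat) : nat := \sum_(1 <= i < N.+1) F i.

Lemma tsum_le N (F F' : nat -> nat) :
  (forall i, 0 < i <= N -> F i <= F' i) -> tsum N F <= tsum N F'.
Proof. by move=> le; rewrite /tsum !big_nat; apply: leq_sum => i /le. Qed.

Lemma tsum_eq N (F F' : nat -> nat) :
  (forall i, 0 < i <= N -> F i = F' i) -> tsum N F = tsum N F'.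
Proof. by move=> e; apply: eq_big_nat => i /e. Qed.

Lemma tsum_const N c : tsum N (fun=> c) = N * c.
Proof. by rewrite /tsum sum_nat_const_nat subn1. Qed.

Lemma tsum_le_const N F c :
  (forall i, 0 < i <= N -> F i <= c) -> tsum N F <= N * c.
Proof. by move=> le; rewrite -(tsum_const N c); apply: tsum_le. Qed.

Lemma tsumD N F F' : tsum N (fun i => F i + F' i) = tsum N F + tsum N F'.
Proof. exact: big_split. Qed.

Lemma tsum_exchange N M (F : nat -> nat -> nat) :
  tsum N (fun i => tsum M (F i)) = tsum M (fun j => tsum N (F^~ j)).
Proof. exact: exchange_big. Qed.

Lemma tsum_split N F u : 0 < u <= N ->
  tsum N F = F u + tsum N (fun i => if i == u then 0 else F i).
Proof.
move=> uN; rewrite /tsum (bigD1_seq u) ?iota_uniq ?mem_index_iota //=.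
congr addn; rewrite big_mkcond /=; apply: eq_bigr => i _.
by case: eqP.
Qed.

Lemma tsum_update N F F' u d : 0 < u <= N ->
  (forall i, 0 < i <= N -> i != u -> F' i <= F i) -> F' u + d <= F u ->
  tsum N F' + d <= tsum N F.
Proof.
move=> uN le leu; rewrite (tsum_split F' uN) (tsum_split F uN).
have: tsum N (fun i => if i == u then 0 else F' i)
      <= tsum N (fun i => if i == u then 0 else F i).
  by apply: tsum_le => i iN; case: eqVneq => // /(le i iN).
by lia.
Qed.

Lemma tsum_pred1 N u : 0 < u <= N -> tsum N (fun i => u == i) = 1.
Proof.
move=> uN; rewrite (tsum_split _ uN) eqxx.
have -> : tsum N (fun i => if i == u then 0 else u == i) = N * 0.
  rewrite -tsum_const; apply: tsum_eq => i _.
  by rewrite [u == i]eq_sym; case: eqP.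
by rewrite muln0.
Qed.

(** Averaging: terms all above [L / N] would each be at least [(L %/ N).+1] and would sum to more
    than [L]. *)
Lemma tsum_min N F (L : nat) : 0 < N ->
  tsum N F <= L -> exists2 i, 0 < i <= N & F i * N <= L.
Proof.
move=> N0 le; have [/hasP[i]|/hasPn no] :=
  boolP (has (fun i => F i * N <= L) (index_iota 1 N.+1)).
  by rewrite mem_index_iota => iN Fi; exists i.
exfalso; have: N * (L %/ N).+1 <= tsum N F.
  rewrite -tsum_const; apply: tsum_le => i iN.
  by rewrite ltn_divLR // ltnNge no // mem_index_iota.
have := ltn_ceil L N0; rewrite mulnC; lia.
Qed.

Section Bipartite.
Variables (N : nat) (bs : seq (nat * nat)).
Implicit Types (mr : nat -> nat) (cl cr : nat -> bool).

Definition bvalid := forall l r, (l, r) \in bs -> 0 < l <= N /\ 0 < r <= N.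

(* [mr r] is the partner of the right vertex [r], or [0] if there is none. *)
Definition matching mr :=
  [/\ forall w, 0 < w <= N -> mr w != 0 -> 0 < mr w <= N,
      forall w, 0 < w <= N -> mr w != 0 -> (mr w, w) \in bs
    & forall w w', 0 < w <= N -> 0 < w' <= N -> mr w != 0 -> mr w = mr w' ->
      w = w'].

Definition msize mr := tsum N (fun w => mr w != 0).

Definition vertex_cover cl cr := forall l r, (l, r) \in bs -> cl l || cr r.

Definition csize cl cr := tsum N cl + tsum N cr.

(** Double counting of the pairs formed by a right vertex and its partner: injectivity leaves at
    most one right vertex for each [l]. *)
Lemma matched_le mr (f : nat -> bool) : matching mr ->
  tsum N (fun w => (mr w != 0) && f (mr w)) <= tsum N f.
Proof.
move=> [mN _ inj].
pose g l w : nat := (mr w == l) && f l.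
apply: (@leq_trans (tsum N (fun w => tsum N (fun l => g l w)))).
  apply: tsum_le => w wN; case: eqVneq => //= mw.
  rewrite (tsum_split _ (mN w wN mw)) /g eqxx /=; lia.
rewrite tsum_exchange; apply: tsum_le => l lN; rewrite /g.
case fl: (f l); last first.
  by rewrite (@tsum_eq _ _ (fun=> 0)) ?tsum_const ?muln0 // => i _; rewrite andbF.
have [/hasP[w]|/hasPn no] := boolP (has (fun w => mr w == l) (index_iota 1 N.+1)).
  rewrite mem_index_iota => wN /eqP mw.
  rewrite -[leqRHS]/1 -[leqRHS](tsum_pred1 wN); apply: tsum_le => i iN; rewrite andbT.
  case: eqP => //= mi; case: eqP => // -[]; apply: inj => //; last by rewrite mw.
  by rewrite mw; lia.
rewrite (@tsum_eq _ _ (fun=> 0)) ?tsum_const ?muln0 // => i iN.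
by rewrite andbT (negPf (no i _)) // mem_index_iota.
Qed.

Lemma matched_ge mr (f : nat -> bool) :
  (forall l, 0 < l <= N -> f l -> exists2 w, 0 < w <= N & mr w = l) ->
  tsum N f <= tsum N (fun w => (mr w != 0) && f (mr w)).
Proof.
move=> all_matched.
pose g l w : nat := (mr w == l) && f l.
apply: (@leq_trans (tsum N (fun l => tsum N (g l)))).
  apply: tsum_le => l lN; case fl: (f l) => //.
  have [w wN mw] := all_matched l lN fl.
  rewrite (tsum_split _ wN) /g mw eqxx fl; lia.
rewrite tsum_exchange; apply: tsum_le => w wN; rewrite /g.
have [mw|/negP mw] := boolP (0 < mr w <= N).
  rewrite (@tsum_eq _ _ (fun l => if mr w == l then f (mr w) : nat else 0)).
    rewrite (tsum_split _ mw) eqxx (@tsum_eq _ _ (fun=> 0)) ?tsum_const.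
      by case/andP: mw; case: (mr w) => //=; lia.
    by move=> i _; rewrite [mr w == i]eq_sym; case: eqP.
  by move=> i iN; case: eqP => // ->.
rewrite (@tsum_eq _ _ (fun=> 0)) ?tsum_const ?muln0 // => i iN.
by case: eqP => // mi; case: mw; rewrite mi.
Qed.

(** Weak duality: each matched edge has a covered end. Right ends are counted directly by [cr], left
    ends through [matched_le]. *)
Lemma matching_le_cover mr cl cr : matching mr -> vertex_cover cl cr ->
  msize mr <= csize cl cr.
Proof.
move=> mM cov; have [mN mE _] := mM.
rewrite /msize /csize.
have := matched_le cl mM.
have: tsum N (fun w => mr w != 0)
   <= tsum N (fun w => (mr w != 0) && cl (mr w)) + tsum N cr.
  rewrite -tsumD; apply: tsum_le => w wN; case: eqVneq => //= mw.
  by have := cov _ _ (mE w wN mw); case: (cl _); case: (cr _).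
lia.
Qed.

(* The invariant [price w <= (lev u).+1] of matched pairs forces a pair counted
   twice by the cover at threshold [i] to have price exactly [i]. *)
Lemma threshold_cover mr (price lev : nat -> nat) L :
  0 < L -> bvalid -> matching mr ->
  (forall w, 0 < w <= N -> price w <= L) ->
  (forall w, 0 < w <= N -> mr w = 0 -> price w = 0) ->
  (forall w, 0 < w <= N -> mr w != 0 -> price w <= (lev (mr w)).+1) ->
  (forall l r, (l, r) \in bs -> lev l <= price r) ->
  (forall l, 0 < l <= N -> lev l < L -> exists2 w, 0 < w <= N & mr w = l) ->
  exists cl cr, [/\ vertex_cover cl cr & (csize cl cr - msize mr) * L <= N].
Proof.
move=> L0 bv mM pL p0 pm lp free.
(* A right vertex has at most one price in [1..L], so these classes have total size at most [N] and
   one of them has at most [N / L] vertices. *)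
pose F i := tsum N (fun w => price w == i).
have [|i iL Fi] := @tsum_min L F N L0.
  rewrite /F tsum_exchange -[X in _ <= X]muln1; apply: tsum_le_const => w wN.
  have [p|p] := boolP (0 < price w <= L); first by rewrite tsum_pred1.
  rewrite (@tsum_eq _ _ (fun=> 0)) ?tsum_const ?muln0 // => j jL.
  by case: eqP p => // ->; rewrite jL.
exists (fun l => lev l < i), (fun r => i <= price r); split.
  move=> l r lr; have := lp _ _ lr; case: ltnP => //= h1 h2; lia.
apply: leq_trans Fi; rewrite leq_mul2r; apply/orP; right.
rewrite leq_subLR /csize /msize.
(* Left vertices of the cover have a level below [i <= L], hence are matched and can be counted at
   their partners. *)
have: tsum N (fun l => lev l < i)
      <= tsum N (fun w => (mr w != 0) && (lev (mr w) < i)).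
  by apply: matched_ge => l lN li; apply: free => //; lia.
move=> h; apply: leq_trans (leq_add h (leqnn _)) _.
rewrite -!tsumD; apply: tsum_le => w wN.
case: eqVneq => mw /=; first by rewrite p0 // [i <= 0]leqNgt; case/andP: iL => ->.
by have := pm w wN mw; case: ltnP; case: ltnP; case: eqP; lia.
Qed.

(** The alternating forest yields Konig's cover: the unreached left vertices and the visited right
    ones. The former are matched, the latter are matched to reached vertices, so each matched pair
    is counted at most once. *)
Lemma konig_cover mr (rch vis : nat -> nat) :
  (forall w, 0 < w <= N -> mr w != 0 -> 0 < mr w <= N) ->
  (forall l r, (l, r) \in bs -> rch l != 0 -> vis r != 0) ->
  (forall w, 0 < w <= N -> vis w != 0 -> mr w != 0 /\ rch (mr w) != 0) ->
  (forall l, 0 < l <= N -> rch l = 0 -> exists2 w, 0 < w <= N & mr w = l) ->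
  exists cl cr, vertex_cover cl cr /\ csize cl cr <= msize mr.
Proof.
move=> mN vE vis_m free.
exists (fun l => rch l == 0), (fun r => vis r != 0); split.
  by move=> l r lr; case: eqP => //= /eqP /(vE _ _ lr).
rewrite /csize /msize.
have h : tsum N (fun l => rch l == 0)
      <= tsum N (fun w => (mr w != 0) && (rch (mr w) == 0)).
  by apply: matched_ge => l lN /eqP; apply: free.
apply: leq_trans (leq_add h (leqnn _)) _.
rewrite -tsumD; apply: tsum_le => w wN.
have := vis_m w wN; case: eqP => //= v; last by move=> [] // -> /negPf ->.
by case: (mr w == 0) => //=; case: (rch _ == 0).
Qed.

End Bipartite.

(** * Adjacency lists and the auction *)

(* Lists are linked by decreasing edge numbers, which start from 1; 0 ends a list.
   [pointer el u b d] says that [d] is the last edge up to [b] leaving [u]. *)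
Definition pointer (el : nat -> nat) u b d :=
  [/\ d <= b, d != 0 -> el d = u & forall i, d < i <= b -> el i != u].

Record adjacency N (bs : seq (nat * nat)) (el er nx hd : nat -> nat) ce : Prop :=
  Adjacency {
    adj_size : ce = size bs;
    adj_nth : forall j, j < ce -> nth (0, 0) bs j = (el j.+1, er j.+1);
    adj_next : forall j, 0 < j <= ce -> pointer el (el j) j.-1 (nx j);
    adj_head : forall u, 0 < u <= N -> pointer el u ce (hd u)
  }.

Lemma adjacency0 N el er nx hd :
  (forall u, 0 < u <= N -> hd u = 0) -> adjacency N [::] el er nx hd 0.
Proof.
move=> hd0; split=> // [j|u /hd0 ->]; first by case: j.
by split=> // i; lia.
Qed.

(** The new edge has the largest number, so the former head of [l] is its successor, and pointers
    bounded by [ce] do not see it. *)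
Lemma adjacency_rcons N bs el er nx hd ce l r :
  0 < l <= N -> adjacency N bs el er nx hd ce ->
  adjacency N (rcons bs (l, r)) (upd el ce.+1 l) (upd er ce.+1 r)
    (upd nx ce.+1 (hd l)) (upd hd l ce.+1) ce.+1.
Proof.
move=> lN [e_ce e_nth e_nx e_hd].
have ptr u b d x : b <= ce -> pointer el u b d -> pointer (upd el ce.+1 x) u b d.
  move=> le_b [p1 p2 p3]; split=> // [d0|i ib].
    by rewrite upd_other ?p2 //; lia.
  by rewrite upd_other ?p3 //; lia.
split.
- by rewrite size_rcons e_ce.
- move=> j; rewrite nth_rcons -e_ce ltnS leq_eqVlt => /orP[/eqP ->|lt_j].
    by rewrite ltnn eqxx !upd_same.
  by rewrite lt_j !upd_other ?e_nth //; lia.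
- move=> j /andP[j0]; rewrite leq_eqVlt => /orP[/eqP -> /=|lt_j].
    by rewrite !upd_same; apply: ptr => //; apply: e_hd.
  rewrite !(upd_other _ _ (_ : j != ce.+1)); try lia.
  by apply: ptr; [lia | apply: e_nx; lia].
- move=> u uN; case: (eqVneq u l) => [->|ul].
    by rewrite upd_same; split=> // [_|i]; rewrite ?upd_same //; lia.
  rewrite upd_other //; have [p1 p2 p3] := e_hd u uN.
  split=> [|d0|i]; first by lia.
    by rewrite upd_other ?p2 //; lia.
  rewrite updE; case: (eqVneq i ce.+1) => [_ _|ne lt_i]; first by rewrite eq_sym.
  by apply: p3; lia.
Qed.

Section Adjacency.
Variables (N : nat) (bs : seq (nat * nat)) (el er nx hd : nat -> nat) (ce : nat).
Hypothesis adjP : adjacency N bs el er nx hd ce.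

Lemma adj_mem j : 0 < j <= ce -> (el j, er j) \in bs.
Proof.
case: adjP => e_ce e_nth _ _; case: j => // j jce.
by rewrite -e_nth // mem_nth // -e_ce.
Qed.

Lemma adj_memP l r : (l, r) \in bs ->
  exists j, [/\ 0 < j <= ce, el j = l & er j = r].
Proof.
case: adjP => e_ce e_nth _ _ lr.
have lt_i : index (l, r) bs < ce by rewrite e_ce index_mem.
have := e_nth _ lt_i; rewrite nth_index // => -[e_l e_r].
by exists (index (l, r) bs).+1; split.
Qed.

(** The length of the list of [l] from edge [c] on, hence the work left for a cursor placed at
    [c]. *)
Definition pending l c := tsum c (fun i => el i == l).

Lemma pending_next c : 0 < c <= ce -> pending (el c) (nx c) < pending (el c) c.
Proof.
case: adjP => _ _ e_nx _ cce; have [le_c _ _] := e_nx c cce.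
rewrite /pending /tsum; case: c cce le_c => // c _ le_c.
rewrite [ltnRHS]big_nat_recr //= eqxx addn1 ltnS.
rewrite [leqRHS](big_cat_nat (n := (nx c.+1).+1)) //=; lia.
Qed.

Lemma pending_le l c : c <= ce -> pending l c <= pending l ce.
Proof.
move=> le_c; rewrite /pending /tsum [leqRHS](big_cat_nat (n := c.+1)) //=.
lia.
Qed.

Lemma pending_tsum : tsum N (fun l => pending l ce) <= ce.
Proof.
rewrite tsum_exchange -[leqRHS]muln1; apply: tsum_le_const => i ice.
have [h|h] := boolP (0 < el i <= N); first by rewrite tsum_pred1.
rewrite (@tsum_eq _ _ (fun=> 0)) ?tsum_const ?muln0 // => j jN.
by case: eqP h => // ->; rewrite jN.
Qed.

(** * The auction: prices, levels and its potential *)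

Section Auction.
Variable L : nat.
Hypotheses (bsN : bvalid N bs) (L_gt0 : 0 < L).
Implicit Types (p mr lv cu : nat -> nat) (u : nat).

(* [p] is the price of a right vertex and [lv] a lower bound for the prices of
   the neighbors of a left vertex; [u] is the left vertex that is bidding
   ([0] if none) and the left vertices above [u0] have not bid yet. *)
Record auction_inv p mr lv cu u u0 : Prop := AuctionInv {
  ai_match : matching N bs mr;
  ai_price : forall w, 0 < w <= N -> p w <= L;
  ai_price0 : forall w, 0 < w <= N -> mr w = 0 -> p w = 0;
  ai_pair : forall w, 0 < w <= N -> mr w != 0 ->
    p w <= (lv (mr w)).+1 /\ lv (mr w) < L;
  ai_level : forall l r, (l, r) \in bs -> lv l <= p r;
  ai_cur : forall l, 0 < l <= N -> cu l <= ce /\ (cu l != 0 -> el (cu l) = l);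
  ai_scanned : forall l j, 0 < l <= N -> lv l < L -> cu l < j <= ce ->
    el j = l -> lv l < p (er j);
  ai_bidder : u != 0 ->
    [/\ 0 < u <= u0, lv u < L & forall w, 0 < w <= N -> mr w != u];
  ai_bound : u0 <= N;
  ai_fresh : forall l, u0 < l <= N ->
    lv l < L /\ forall w, 0 < w <= N -> mr w != l;
  ai_done : forall l, 0 < l <= u0 -> lv l < L -> l != u ->
    exists2 w, 0 < w <= N & mr w = l
}.

(** A left vertex keeps in reserve, for each level still to climb, one relabelling and one scan of
    its whole list, besides the rest of the current scan. A right vertex reserves its possible price
    rises, and the last summand counts the vertices that have yet to enter. *)
Definition auction_pot p lv cu u0 :=
  tsum N (fun l => (L - lv l) * (pending l ce).+1 + pending l (cu l))
  + tsum N (fun w => L - p w) + (N - u0).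

(** As [lv u] bounds the prices around [u] from below, the accepted price equals [lv u] and rises by
    one. Prices only grow, so earlier scans stay valid. The displaced partner [mr w], or 0, becomes
    the bidder; by the invariant of pairs its level is still below [L]. *)
Lemma auction_bid p mr lv cu u u0 :
  auction_inv p mr lv cu u u0 -> u != 0 -> cu u != 0 ->
  let w := er (cu u) in p w <= lv u ->
  auction_inv (upd p w (lv u).+1) (upd mr w u) lv cu (mr w) u0 /\
  auction_pot (upd p w (lv u).+1) lv cu u0 < auction_pot p lv cu u0.
Proof.
move=> [[mN mE inj] pL p0 pm lp cur sc bid u0N fresh dn] un0 cn0 w le_p.
have [uu0 uL ufree] := bid un0; have uN : 0 < u <= N by lia.
have [cu_le cu_el] := cur u uN.
have uw : (u, w) \in bs by rewrite -{1}(cu_el cn0) adj_mem //; lia.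
have [_ wN] := bsN uw.
have p_up x : p x <= upd p w (lv u).+1 x.
  by rewrite updE; case: eqP => // ->; lia.
split; last first.
  rewrite /auction_pot ltn_add2r -addnS leq_add2l -addn1.
  apply: (tsum_update wN) => [i iN iw|]; first by rewrite upd_other.
  by rewrite upd_same; lia.
split=> //.
- split=> x.
  + by rewrite updE; case: (x =P w) => // _; apply: mN.
  + by rewrite updE; case: (x =P w) => [->|_] //; apply: mE.
  + move=> y xN yN; rewrite !updE; case: (eqVneq x w) => [->|xw].
      by case: (eqVneq y w) => // _ _ uy; have := ufree y yN; rewrite -uy eqxx.
    case: (eqVneq y w) => [_ _ ux|_]; last exact: inj.
    by have := ufree x xN; rewrite ux eqxx.
- by move=> x xN; rewrite updE; case: (x =P w) => // _; apply: pL.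
- move=> x xN; rewrite !updE; case: (x =P w) => _; last exact: p0.
  by move/eqP: un0.
- by move=> x xN; rewrite !updE; case: (x =P w) => // _; apply: pm.
- by move=> l r lr; apply: leq_trans (lp _ _ lr) (p_up _).
- by move=> l j lN lL jl ej; apply: leq_trans (p_up _); apply: sc lL jl ej.
- move=> mw; have [_ lvL] := pm w wN mw; split=> //.
    have := mN w wN mw; case: (leqP (mr w) u0) => // h h2; first by lia.
    have [|_ /(_ w wN)] := fresh (mr w); [lia | by rewrite eqxx].
  move=> x xN; rewrite updE; case: (x =P w) => [_|/eqP xw].
    by rewrite eq_sym; apply: ufree.
  apply: contraNneq xw => e; apply/eqP; apply: inj => //; by rewrite e.
- move=> l lN; have [lL lf] := fresh l lN; split=> // x xN.
  rewrite updE; case: (x =P w) => _; last exact: lf.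
  by lia.
- move=> l lu lL lw; case: (eqVneq l u) => [->|lu'].
    by exists w => //; rewrite upd_same.
  have [x xN mx] := dn l lu lL lu'; exists x => //.
  by rewrite upd_other //; apply: contraNneq lw => <-; rewrite mx.
Qed.

(** The edge at the cursor is too dear at the present level and, prices never falling, needs no
    second look before the level rises. *)
Lemma auction_advance p mr lv cu u u0 :
  auction_inv p mr lv cu u u0 -> u != 0 -> cu u != 0 ->
  lv u < p (er (cu u)) ->
  auction_inv p mr lv (upd cu u (nx (cu u))) u u0 /\
  auction_pot p lv (upd cu u (nx (cu u))) u0 < auction_pot p lv cu u0.
Proof.
move=> [mM pL p0 pm lp cur sc bid u0N fresh dn] un0 cn0 lt_p.
have [uu0 uL ufree] := bid un0; have uN : 0 < u <= N by lia.
have [cu_le cu_el] := cur u uN.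
have cce : 0 < cu u <= ce by lia.
have [nx_le nx_el nx_no] := adj_next adjP cce; rewrite (cu_el cn0) in nx_el nx_no.
split; last first.
  rewrite /auction_pot !ltn_add2r -addn1.
  apply: (tsum_update uN) => [i iN iu|]; first by rewrite upd_other.
  rewrite upd_same -addnA leq_add2l addn1.
  by have := pending_next cce; rewrite (cu_el cn0).
split=> //.
- move=> l lN; rewrite updE; case: (l =P u) => [->|_]; last exact: cur.
  by split=> //; lia.
- move=> l j lN lL; rewrite updE; case: (l =P u) => [->|_]; last exact: sc.
  case: (ltngtP j (cu u)) => [lt_j jl ej|lt_j jl ej|-> _ _] //.
    by have := nx_no j; rewrite ej eqxx => /(_ ltac:(lia)).
  by have := sc u j uN uL _ ej; apply; lia.
Qed.

(** An exhausted cursor means that all neighbors of [u] cost more than [lv u], so this lower bound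
    can be raised and the scan restarted. *)
Lemma auction_relabel p mr lv cu u u0 :
  auction_inv p mr lv cu u u0 -> u != 0 -> cu u = 0 -> (lv u).+1 < L ->
  auction_inv p mr (upd lv u (lv u).+1) (upd cu u (hd u)) u u0 /\
  auction_pot p (upd lv u (lv u).+1) (upd cu u (hd u)) u0
    < auction_pot p lv cu u0.
Proof.
move=> [mM pL p0 pm lp cur sc bid u0N fresh dn] un0 c0 lt_L.
have [uu0 uL ufree] := bid un0; have uN : 0 < u <= N by lia.
have [hd_le hd_el hd_no] := adj_head adjP uN.
split; last first.
  rewrite /auction_pot !ltn_add2r -addn1.
  apply: (tsum_update uN) => [i iN iu|]; first by rewrite !upd_other.
  rewrite !upd_same c0; have := pending_le u hd_le.
  have -> : L - lv u = (L - (lv u).+1).+1 by lia.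
  rewrite mulSn; lia.
split=> //.
- move=> w wN mw; have := ufree w wN; have [] := pm w wN mw.
  by move=> ? ?; rewrite updE; case: (mr w =P u).
- move=> l r lr; rewrite updE; case: (l =P u) => [lu|_]; last exact: lp.
  have [j [jce ej <-]] := adj_memP lr; rewrite -lu.
  by apply: sc => //; rewrite ?lu ?c0 //; lia.
- move=> l lN; rewrite updE; case: (l =P u) => [->|_]; last exact: cur.
  by split.
- move=> l j lN; rewrite !updE; case: (eqVneq l u) => [->|_]; last exact: sc.
  by move=> _ jl ej; have := hd_no j jl; rewrite ej eqxx.
- by move=> _; split=> //; rewrite upd_same.
- move=> l lN; have [] := fresh l lN; rewrite updE; case: (l =P u) => //; lia.
- move=> l lN; rewrite updE; case: (eqVneq l u) => // lu lL _; exact: dn.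
Qed.

(** At level [L] all neighbors of [u] have the maximal price; [u] gives up for good, and [ai_done]
    claims nothing about it any more. *)
Lemma auction_drop p mr lv cu u u0 :
  auction_inv p mr lv cu u u0 -> u != 0 -> cu u = 0 -> L <= (lv u).+1 ->
  auction_inv p mr (upd lv u (lv u).+1) cu 0 u0 /\
  auction_pot p (upd lv u (lv u).+1) cu u0 < auction_pot p lv cu u0.
Proof.
move=> [mM pL p0 pm lp cur sc bid u0N fresh dn] un0 c0 le_L.
have [uu0 uL ufree] := bid un0; have uN : 0 < u <= N by lia.
split; last first.
  rewrite /auction_pot !ltn_add2r -addn1.
  apply: (tsum_update uN) => [i iN iu|]; first by rewrite !upd_other.
  rewrite !upd_same.
  have -> : L - lv u = (L - (lv u).+1).+1 by lia.
  rewrite mulSn; lia.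
split=> //.
- move=> w wN mw; have := ufree w wN; have [] := pm w wN mw.
  by move=> ? ?; rewrite updE; case: (mr w =P u).
- move=> l r lr; rewrite updE; case: (l =P u) => [lu|_]; last exact: lp.
  have [j [jce ej <-]] := adj_memP lr; rewrite -lu.
  by apply: sc => //; rewrite ?lu ?c0 //; lia.
- move=> l j lN; rewrite !updE; case: (eqVneq l u) => [->|_]; last exact: sc.
  by lia.
- move=> l lN; have [] := fresh l lN; rewrite updE; case: (l =P u) => //; lia.
- move=> l lN; rewrite updE; case: (eqVneq l u) => [->|lu] lL _; [lia | exact: dn].
Qed.

Lemma auction_next p mr lv cu u0 :
  auction_inv p mr lv cu 0 u0 -> u0 < N ->
  auction_inv p mr lv cu u0.+1 u0.+1 /\
  auction_pot p lv cu u0.+1 < auction_pot p lv cu u0.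
Proof.
move=> [mM pL p0 pm lp cur sc bid u0N fresh dn] lt_u0.
split; last by rewrite /auction_pot; lia.
split=> //.
- by move=> _; have [|? ?] := fresh u0.+1; [lia | split; rewrite ?leqnn].
- by move=> l lN; apply: fresh; lia.
- by move=> l lN lL lu; apply: dn => //; lia.
Qed.

(** The lists have at most [ce] edges together, so the left vertices start with at most
    [(L + 1) * (N + ce)]; price rises and entries account for [N * (L + 1)]. *)
Lemma auction_init p mr lv cu :
  (forall i, 0 < i <= N -> [/\ p i = 0, mr i = 0, lv i = 0 & cu i = hd i]) ->
  auction_inv p mr lv cu 0 0 /\
  auction_pot p lv cu 0 <= (L + 1) * (N + ce) + N * (L + 1).
Proof.
move=> z; split.
  split=> //.
  - split=> [w /z[_ -> _ _]|w /z[_ -> _ _]|w w' /z[_ -> _ _]] //.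
  - by move=> w /z[-> _ _ _].
  - by move=> w /z[-> _ _ _].
  - by move=> w /z[_ -> _ _].
  - by move=> l r /bsN[/z[_ _ -> _]].
  - by move=> l lN; have [_ _ _ ->] := z l lN; have [] := adj_head adjP lN.
  - move=> l j lN _; have [_ _ _ ->] := z l lN => jl ej.
    by have [_ _ /(_ j jl)] := adj_head adjP lN; rewrite ej eqxx.
  - move=> l lN; have [_ _ -> _] := z l lN; split=> // w /z[_ -> _ _]; lia.
  - by case.
rewrite /auction_pot subn0.
have h1 : tsum N (fun w => L - p w) <= N * L.
  by apply: tsum_le_const => i _; lia.
set t := tsum N _.
have h2 : t <= tsum N (fun l => (L + 1) * (1 + pending l ce)).
  apply: tsum_le => l lN; have [_ _ -> ->] := z l lN.
  have [hd_le _ _] := adj_head adjP lN.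
  have := pending_le l hd_le; nia.
have h3 : tsum N (fun l => (L + 1) * (1 + pending l ce))
          = (L + 1) * (N * 1 + tsum N (fun l => pending l ce)).
  by rewrite -[N * 1](tsum_const N 1) -tsumD /tsum -big_distrr.
have := pending_tsum; nia.
Qed.

End Auction.
End Adjacency.

(** * Search for augmenting paths *)

Section Search.
Variables (N : nat) (bs : seq (nat * nat)) (el er nx hd : nat -> nat) (ce : nat).
Hypothesis adjP : adjacency N bs el er nx hd ce.
Hypothesis bsN : bvalid N bs.
Variable mr : nat -> nat.
Hypothesis mrP : matching N bs mr.
Implicit Types (vis par rch via cu stk : nat -> nat) (rk top fnd : nat).

Definition unmatched u := forall w, 0 < w <= N -> mr w != u.

(* A visited right vertex [w] was reached from the left vertex [par w], at time
   [vis w]; a reached left vertex [u] was reached from its partner [via u], or is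
   unmatched if [via u = 0]. *)
Record trace vis par rch via rk : Prop := Trace {
  tr_vis : forall w, 0 < w <= N -> vis w != 0 ->
    [/\ vis w <= rk, 0 < par w <= N, (par w, w) \in bs, rch (par w) != 0
      & via (par w) != 0 -> vis (via (par w)) < vis w];
  tr_root : forall u, 0 < u <= N -> rch u != 0 -> via u = 0 -> unmatched u;
  tr_via : forall u, 0 < u <= N -> rch u != 0 -> via u != 0 ->
    [/\ 0 < via u <= N, mr (via u) = u & vis (via u) != 0];
  tr_rank : rk + tsum N (fun w => vis w == 0) <= N
}.

(** The search stops at the first free right vertex, so while it lasts all visited ones are matched.
    A reached vertex with a nonzero cursor lies on the stack; an empty stack thus means that all
    reached lists have been scanned. *)
Record search_inv vis par rch via cu stk rk top : Prop := SearchInv {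
  si_trace : trace vis par rch via rk;
  si_free : forall u, 0 < u <= N -> unmatched u -> rch u != 0;
  si_match : forall w, 0 < w <= N -> vis w != 0 ->
    mr w != 0 /\ rch (mr w) != 0;
  si_scanned : forall u j, 0 < u <= N -> rch u != 0 -> cu u < j <= ce ->
    el j = u -> vis (er j) != 0;
  si_cur : forall u, 0 < u <= N -> cu u <= ce /\ (cu u != 0 -> el (cu u) = u);
  si_fresh : forall u, 0 < u <= N -> rch u = 0 -> cu u = hd u;
  si_open : forall u, 0 < u <= N -> rch u != 0 -> cu u != 0 ->
    exists2 i, 0 < i <= top & stk i = u;
  si_stack : forall i, 0 < i <= top -> 0 < stk i <= N /\ rch (stk i) != 0
}.

Definition found_inv vis par rch via rk fnd :=
  [/\ trace vis par rch via rk, 0 < fnd <= N, vis fnd != 0 & mr fnd = 0].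

(** A visit releases two units, enough for the vertex that it pushes; skipped edges are paid by the
    pending ones and pops by the height of the stack. *)
Definition search_pot vis cu top :=
  top + 2 * tsum N (fun w => vis w == 0)
  + tsum N (fun u => pending el u (cu u)).

Lemma search_init vis par rch via cu stk top :
  (forall i, 0 < i <= N -> [/\ vis i = 0, via i = 0 & cu i = hd i]) ->
  (forall u, 0 < u <= N -> rch u != 0 <-> unmatched u) ->
  (forall i, 0 < i <= top -> 0 < stk i <= N /\ rch (stk i) != 0) ->
  (forall u, 0 < u <= N -> rch u != 0 -> exists2 i, 0 < i <= top & stk i = u) ->
  top <= N ->
  search_inv vis par rch via cu stk 0 top /\
  search_pot vis cu top <= 3 * N + ce.
Proof.
move=> z rchP stkP opn topN; split.
  split=> //.
  - split.
    + by move=> w /z[-> _ _].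
    + by move=> u uN /rchP-/(_ uN).
    + by move=> u /z[_ -> _].
    + rewrite add0n -[leqRHS]muln1; apply: tsum_le_const => i _; lia.
  - by move=> u uN /rchP; apply.
  - by move=> w /z[-> _ _].
  - move=> u j uN _; have [_ _ ->] := z u uN => jl ej.
    by have [_ _ /(_ j jl)] := adj_head adjP uN; rewrite ej eqxx.
  - by move=> l lN; have [_ _ ->] := z l lN; have [] := adj_head adjP lN.
  - by move=> u /z[_ _ ->].
  - by move=> u uN ru _; apply: opn.
rewrite /search_pot.
have : tsum N (fun w => vis w == 0) <= N * 1 by apply: tsum_le_const => i _; lia.
have : tsum N (fun u => pending el u (cu u)) <= tsum N (fun u => pending el u ce).
  apply: tsum_le => u uN; have [_ _ ->] := z u uN.
  by apply: pending_le; have [] := adj_head adjP uN.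
have := pending_tsum N el ce; lia.
Qed.

Section Step.
Variables (vis par rch via cu stk : nat -> nat) (rk top : nat).
Hypothesis inv : search_inv vis par rch via cu stk rk top.
Hypothesis top_gt0 : top != 0.
Let u := stk top.

Lemma search_pop : cu u = 0 ->
  search_inv vis par rch via cu stk rk top.-1 /\
  search_pot vis cu top.-1 < search_pot vis cu top.
Proof.
move=> c0; split; last by rewrite /search_pot; lia.
case: inv => tr fr ma sc cur frsh opn st; split=> //.
  move=> v vN rv cv; have [i it e] := opn v vN rv cv; exists i => //.
  suff : i != top by lia.
  by apply: contra_neq cv => e'; rewrite -e e' c0.
by move=> i it; apply: st; lia.
Qed.

Hypothesis cu_neq0 : cu u != 0.
Let c := cu u.
Let w := er c.
Let cu' := upd cu u (nx c).

Let uN : 0 < u <= N. Proof. by case: (si_stack inv (i := top)) => //; lia. Qed.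
Let ru : rch u != 0. Proof. by case: (si_stack inv (i := top)) => //; lia. Qed.
Let c_ce : 0 < c <= ce.
Proof. by case: (si_cur inv uN) => h _; rewrite lt0n cu_neq0. Qed.
Let el_c : el c = u. Proof. by case: (si_cur inv uN) => _; apply. Qed.
Let uw : (u, w) \in bs. Proof. by rewrite -el_c (adj_mem adjP). Qed.
Let wN : 0 < w <= N. Proof. by case: (bsN uw). Qed.

Let cur' v : 0 < v <= N -> cu' v <= ce /\ (cu' v != 0 -> el (cu' v) = v).
Proof.
move=> vN; rewrite /cu' updE; case: (v =P u) => [->|_]; last exact: (si_cur inv).
have [h1 h2 _] := adj_next adjP c_ce; rewrite el_c in h2.
by split=> //; lia.
Qed.

Let scanned' vis' : (forall x, vis x != 0 -> vis' x != 0) -> vis' w != 0 ->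
  forall v j, 0 < v <= N -> rch v != 0 -> cu' v < j <= ce -> el j = v ->
    vis' (er j) != 0.
Proof.
move=> visW visw v j vN rv; rewrite /cu' updE.
case: (v =P u) => [->|_]; last by move=> *; apply/visW/(si_scanned inv vN).
have [h1 h2 h3] := adj_next adjP c_ce; rewrite el_c in h3.
case: (ltngtP j c) => [lt_j jl ej|lt_j jl ej|-> _ _] //.
  by have := h3 j; rewrite ej eqxx => /(_ ltac:(lia)).
by apply: visW; apply: (si_scanned inv uN) => //; lia.
Qed.

Let pending' : tsum N (fun v => pending el v (cu' v))
               < tsum N (fun v => pending el v (cu v)).
Proof.
rewrite -addn1; apply: (tsum_update uN) => [i iN iu|].
  by rewrite /cu' upd_other.
by rewrite /cu' upd_same addn1; have := pending_next adjP c_ce; rewrite el_c.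
Qed.

Lemma search_skip : vis w != 0 ->
  search_inv vis par rch via cu' stk rk top /\
  search_pot vis cu' top < search_pot vis cu top.
Proof.
move=> vw; split; last by rewrite /search_pot ltn_add2l; exact: pending'.
have [tr fr ma sc cur frsh opn st] := inv; split=> //; first exact: scanned'.
  move=> v vN rv; rewrite /cu' upd_other; first exact: frsh.
  by apply: contraNneq ru => <-; rewrite rv.
move=> v vN rv; rewrite /cu' updE; case: (v =P u) => [->|_]; last exact: opn.
by exists top => //; lia.
Qed.

Hypothesis vis_w : vis w = 0.
Let vis' := upd vis w rk.+1.
Let par' := upd par w u.

Let visW x : vis x != 0 -> vis' x != 0.
Proof. by rewrite /vis' updE; case: (x =P w). Qed.

Let vis_lt : tsum N (fun w => vis' w == 0) + 1 <= tsum N (fun w => vis w == 0).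
Proof.
apply: (tsum_update wN) => [i iN iw|]; first by rewrite /vis' upd_other.
by rewrite /vis' upd_same vis_w.
Qed.

(** Common to both outcomes of a visit: [rch'] and [via'] gain at most the partner of [w]. The fresh
    time [rk.+1] exceeds all former ones, so the right vertex through which [u] was reached precedes
    [w]. *)
Lemma search_visit rch' via' :
  (forall x, rch x != 0 -> rch' x != 0 /\ via' x = via x) ->
  (forall x, 0 < x <= N -> rch' x != 0 ->
    rch x != 0 \/ [/\ via' x = w, via' x != 0 & mr w = x]) ->
  trace vis' par' rch' via' rk.+1.
Proof.
have [[tvis troot tvia trank] fr ma sc cur frsh opn st] := inv.
move=> rchW rch'P.
(* No reached vertex came from [w], which was unvisited, so its new time disturbs no earlier
   comparison. *)
have via_w x : 0 < x <= N -> rch x != 0 -> via x != w.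
  move=> xN rx; apply/eqP => e; have [|_ _] := tvia x xN rx; rewrite e ?vis_w //.
  by move: wN; case: (w).
split.
- move=> x xN; rewrite /vis' /par' !updE; case: (x =P w) => [-> _|_ vx].
    have [ru' eu] := rchW u ru; split=> //; rewrite eu => vu.
    rewrite (negPf (via_w _ uN ru)).
    have [vN _ vv] := tvia u uN ru vu; have [] := tvis _ vN vv; lia.
  have [h1 h2 h3 h4 h5] := tvis x xN vx; have [rp ep] := rchW _ h4.
  split=> //; first by lia.
  by rewrite ep (negPf (via_w _ h2 h4)).
- move=> x xN /(rch'P x xN)[rx|[-> + _] e]; last by rewrite e.
  by have [_ ->] := rchW x rx; apply: troot.
- move=> x xN /(rch'P x xN)[rx|[-> _ e] _].
    have [_ ->] := rchW x rx => vx; have [h1 h2 h3] := tvia x xN rx vx.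
    by split=> //; apply: visW.
  by split=> //; rewrite /vis' upd_same.
- have := vis_lt; lia.
Qed.

Lemma search_found : mr w = 0 ->
  found_inv vis' par' rch via rk.+1 w /\
  search_pot vis' cu' 0 < search_pot vis cu top.
Proof.
move=> mw; split; last by have := vis_lt; have := pending'; rewrite /search_pot; lia.
split=> //; last by rewrite /vis' upd_same.
by apply: search_visit => // x xN; left.
Qed.

Lemma search_push : mr w != 0 ->
  search_inv vis' par' (upd rch (mr w) 1) (upd via (mr w) w) cu'
    (upd stk top.+1 (mr w)) rk.+1 top.+1 /\
  search_pot vis' cu' top.+1 < search_pot vis cu top.
Proof.
move=> mw; split; last by have := vis_lt; have := pending'; rewrite /search_pot; lia.
have [tr fr ma sc cur frsh opn st] := inv.
have [mN mE inj] := mrP.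
(* A matched vertex is reached only through its partner, here [w], which was unvisited. *)
have rmw : rch (mr w) = 0.
  apply/eqP; apply: contraTT isT => rmw.
  have mwN := mN w wN mw.
  case: (eqVneq (via (mr w)) 0) => [v0|v0].
    by have := tr_root tr mwN rmw v0 wN; rewrite eqxx.
  have [vN e vv] := tr_via tr mwN rmw v0.
  by move: vv; rewrite (inj _ _ vN wN _ e) ?e // vis_w.
split=> //.
- apply: search_visit => x.
    move=> rx; have xm : x != mr w by apply: contraNneq rx => ->; rewrite rmw.
    by rewrite !upd_other.
  move=> xN; rewrite !updE; case: (x =P mr w) => [-> _|_ rx]; last by left.
  by right; split=> //; move: wN; case: (w).
- by move=> x xN /(fr x xN); rewrite updE; case: (x =P mr w).
- move=> x xN; rewrite /vis' updE; case: (x =P w) => [-> _|_ /(ma x xN)[m1 r1]].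
    by rewrite upd_same.
  by split=> //; rewrite updE; case: (mr x =P mr w).
- move=> x j xN; rewrite updE; case: (x =P mr w) => [xm _|_]; last first.
    by apply: scanned' => //; rewrite /vis' upd_same.
  rewrite {1}/cu' upd_other; last first.
    by apply: contraNneq ru => <-; rewrite xm rmw.
  have -> : cu x = hd x by apply: frsh; rewrite // xm.
  move=> jl ej.
  by have [_ _ /(_ j jl)] := adj_head adjP xN; rewrite ej eqxx.
- move=> x xN; rewrite updE; case: (x =P mr w) => // _ rx.
  rewrite /cu' upd_other; first exact: frsh.
  by apply: contraNneq ru => <-; rewrite rx.
- move=> x xN; rewrite !updE; case: (x =P mr w) => [xm _ _|_ rx].
    by exists top.+1; rewrite ?upd_same ?leqnn // xm.
  rewrite /cu' updE; case: (x =P u) => [-> _|_ cx].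
    by exists top; rewrite ?upd_other //; lia.
  have [i it e] := opn x xN rx cx; exists i; first by lia.
  by rewrite upd_other //; lia.
- move=> i it; rewrite !(updE stk); case: (i =P top.+1) => [_|it'].
    by rewrite upd_same; split=> //; apply: mN.
  have [|h1 h2] := st i; first by lia.
  by split=> //; rewrite updE; case: (stk i =P mr w).
Qed.

End Step.

(** With an empty stack every edge from a reached vertex leads to a visited one, so the forest gives
    a cover that proves the matching maximum. *)
Lemma search_failure vis par rch via cu stk rk :
  search_inv vis par rch via cu stk rk 0 ->
  exists cl cr, vertex_cover bs cl cr /\ csize N cl cr <= msize N mr.
Proof.
move=> [tr fr ma sc cur frsh opn st]; have [mN mE inj] := mrP.
apply: (@konig_cover _ _ _ rch vis) => //.
  move=> l r lr rl; have [lN rN] := bsN lr.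
  have [j [jce ej <-]] := adj_memP adjP lr.
  apply: (sc _ _ lN rl _ ej); case: (eqVneq (cu l) 0) => [->//|cl].
  by have [i] := opn l lN rl cl; lia.
move=> l lN rl.
have [/hasP[w]|/hasPn no] := boolP (has (fun w => mr w == l) (index_iota 1 N.+1)).
  by rewrite mem_index_iota => wN /eqP; exists w.
have /eqP := rl; rewrite (negPf (fr l lN _)) // => w wN.
by apply: no; rewrite mem_index_iota.
Qed.

(** * Flipping the matching along an augmenting path *)

Section Augment.
Variables (vis par rch via : nat -> nat) (rk : nat).
Hypothesis trP : trace vis par rch via rk.

(* Along the augmenting path, [w] is the right vertex about to receive its new
   partner; the vertices still to be treated were visited before [w]. *)
Record augment_inv (mr1 : nat -> nat) w : Prop := AugmentInv {
  ag_range : 0 < w <= N;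
  ag_vis : vis w != 0;
  ag_mN : forall x, 0 < x <= N -> mr1 x != 0 -> 0 < mr1 x <= N;
  ag_mE : forall x, 0 < x <= N -> mr1 x != 0 -> (mr1 x, x) \in bs;
  ag_inj : forall x y, 0 < x <= N -> 0 < y <= N -> x != w -> y != w ->
    mr1 x != 0 -> mr1 x = mr1 y -> x = y;
  ag_free : forall u x, 0 < u <= N -> rch u != 0 -> via u = 0 ->
    0 < x <= N -> x != w -> mr1 x != u;
  ag_old : forall x, 0 < x <= N -> vis x <= vis w -> mr1 x = mr x;
  ag_size : msize N (upd mr1 w 1) = (msize N mr).+1
}.

Lemma augment_init w0 : 0 < w0 <= N -> mr w0 = 0 -> vis w0 != 0 ->
  augment_inv mr w0.
Proof.
move=> w0N mr_w0 v0; have [mN mE inj] := mrP; split=> //.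
- by move=> x y xN yN _ _; apply: inj.
- by move=> u x uN ru vu xN _; apply: (tr_root trP uN ru vu).
- rewrite /msize (tsum_split _ w0N) upd_same add1n; congr _.+1.
  rewrite [RHS](tsum_split _ w0N) mr_w0; apply: tsum_eq => i _.
  by rewrite updE; case: (i =P w0).
Qed.

(** Giving [u] to [w] finishes the path if [u] was unmatched; otherwise [u] is matched twice for a
    moment, and its former partner [via u] is served next. Visit times decrease along the path, so
    no vertex is served twice. *)
Lemma augment_step mr1 w : augment_inv mr1 w ->
  let u := par w in
  if via u == 0 then matching N bs (upd mr1 w u) /\
    msize N (upd mr1 w u) = (msize N mr).+1
  else augment_inv (upd mr1 w u) (via u) /\ vis (via u) < vis w.
Proof.
move=> [wN vw mN mE inj fr old sz] u.
have [_ uN uw ru v_lt] := tr_vis trP wN vw; rewrite -/u in uN uw ru v_lt.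
have u0 : u != 0 by lia.
have mN' x : 0 < x <= N -> upd mr1 w u x != 0 -> 0 < upd mr1 w u x <= N.
  by move=> xN; rewrite updE; case: (x =P w) => // _; apply: mN.
have mE' x : 0 < x <= N -> upd mr1 w u x != 0 -> (upd mr1 w u x, x) \in bs.
  by move=> xN; rewrite updE; case: (x =P w) => [->|_] //; apply: mE.
(* Only being nonzero counts, so the placeholder 1 of [ag_size] can stand for any partner. *)
have sz' : msize N (upd mr1 w u) = msize N (upd mr1 w 1).
  by apply: tsum_eq => x _; rewrite !updE; case: (x =P w) => // _; rewrite u0.
case: (eqVneq (via u) 0) => [v0|v0].
  split; last by rewrite sz'.
  split=> // x y xN yN; rewrite !updE.
  case: (eqVneq x w) => [->|xw]; case: (eqVneq y w) => [->|yw] //.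
  - by move=> _ e; have := fr u y uN ru v0 yN yw; rewrite -e eqxx.
  - by move=> _ e; have := fr u x uN ru v0 xN xw; rewrite e eqxx.
  - exact: inj.
have [vN mv vv] := tr_via trP uN ru v0; have lt_v := v_lt v0.
have vw' : via u != w by apply: contraTneq lt_v => ->; rewrite ltnn.
(* [via u] was visited before [w], so it still has its partner from [mr]. *)
have mr1v : mr1 (via u) = u by rewrite old // ltnW.
split=> //; split=> //.
- move=> x y xN yN xv yv; rewrite !updE.
  case: (eqVneq x w) => [->|xw]; case: (eqVneq y w) => [->|yw] //; last exact: inj.
  - by rewrite -mr1v => m0 /(inj _ _ vN yN vw' yw m0) e; rewrite e eqxx in yv.
  - by rewrite -mr1v => m0 /(inj _ _ xN vN xw vw' m0) e; rewrite e eqxx in xv.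
- move=> u' x uN' ru' vu' xN xv; rewrite updE; case: (x =P w) => [_|/eqP xw].
    by apply: contraNneq v0 => ->; rewrite vu'.
  exact: fr vu' xN xw.
- move=> x xN le_x; rewrite upd_other; first by apply: old => //; lia.
  by apply: contraTneq le_x => ->; rewrite -ltnNge.
- rewrite -sz -sz'; apply: tsum_eq => x _; rewrite updE.
  by case: (x =P via u) => // ->; rewrite upd_other // mr1v u0.
Qed.

End Augment.

End Search.

(** * Programs for the matching *)

Notation aIn := 0 (only parsing).
Notation aOut := 1 (only parsing).
Notation aS := 2 (only parsing).
Notation aT := 3 (only parsing).
Notation aN := 4 (only parsing).
Notation aM := 5 (only parsing).
Notation aCol := 6 (only parsing).
Notation aEU := 7 (only parsing).
Notation aEV := 8 (only parsing).
Notation aRep := 9 (only parsing).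
Notation aI := 10 (only parsing).
Notation aJ := 11 (only parsing).
Notation aX := 12 (only parsing).
Notation aY := 13 (only parsing).
Notation aNN := 14 (only parsing).
Notation aCE := 15 (only parsing).
Notation aEL := 16 (only parsing).
Notation aER := 17 (only parsing).
Notation aNX := 18 (only parsing).
Notation aHD := 19 (only parsing).
Notation aL := 20 (only parsing).
Notation aSQ := 21 (only parsing).
Notation aP := 22 (only parsing).
Notation aMR := 23 (only parsing).
Notation aLV := 24 (only parsing).
Notation aCU := 25 (only parsing).
Notation aU := 26 (only parsing).
Notation aU0 := 27 (only parsing).
Notation aC := 28 (only parsing).
Notation aW := 29 (only parsing).
Notation aRCH := 30 (only parsing).
Notation aVIA := 31 (only parsing).
Notation aVIS := 32 (only parsing).
Notation aPAR := 33 (only parsing).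
Notation aSTK := 34 (only parsing).
Notation aTOP := 35 (only parsing).
Notation aRK := 36 (only parsing).
Notation aFND := 37 (only parsing).
Notation aGO := 38 (only parsing).
Notation aRes := 39 (only parsing).

Notation Minus := Defs.Sub (only parsing).
Definition Plus1 (e : expr) : expr := Add e (Const 1).

Definition auction_step : prog :=
  If (Var aU)
    (Seq (Assign aC (Read aCU (Var aU)))
    (If (Var aC)
      (Seq (Assign aW (Read aER (Var aC)))
      (If (Minus (Plus1 (Read aLV (Var aU))) (Read aP (Var aW)))
        (Seq (Write aP (Var aW) (Plus1 (Read aLV (Var aU))))
        (Seq (Assign aX (Read aMR (Var aW)))
        (Seq (Write aMR (Var aW) (Var aU))
             (Assign aU (Var aX)))))
        (Write aCU (Var aU) (Read aNX (Var aC)))))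
      (Seq (Write aLV (Var aU) (Plus1 (Read aLV (Var aU))))
      (If (Minus (Var aL) (Read aLV (Var aU)))
        (Write aCU (Var aU) (Read aHD (Var aU)))
        (Assign aU (Const 0))))))
    (Seq (Assign aU0 (Plus1 (Var aU0))) (Assign aU (Var aU0))).

Definition auction_prog : prog :=
  Seq (For aI aNN
    (Seq (Write aP (Plus1 (Var aI)) (Const 0))
    (Seq (Write aMR (Plus1 (Var aI)) (Const 0))
    (Seq (Write aLV (Plus1 (Var aI)) (Const 0))
         (Write aCU (Plus1 (Var aI)) (Read aHD (Plus1 (Var aI))))))))
  (Seq (Assign aU (Const 0))
  (Seq (Assign aU0 (Const 0))
       (While (Add (Var aU) (Minus (Var aNN) (Var aU0))) auction_step))).

Definition adjacency_mem N bs (m : memory) :=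
  adjacency N bs (m aEL) (m aER) (m aNX) (m aHD) (m aCE 0).

Lemma auction_stepP N bs L (m : memory) :
  adjacency_mem N bs m -> bvalid N bs -> 0 < L -> m aNN 0 = N -> m aL 0 = L ->
  auction_inv N bs (m aEL) (m aER) (m aCE 0) L (m aP) (m aMR) (m aLV) (m aCU)
    (m aU 0) (m aU0 0) ->
  m aU 0 + (N - m aU0 0) != 0 ->
  wp auction_step m 0 (fun m' =>
    auction_inv N bs (m aEL) (m aER) (m aCE 0) L
      (m' aP) (m' aMR) (m' aLV) (m' aCU) (m' aU 0) (m' aU0 0) /\
    auction_pot N (m aEL) (m aCE 0) L (m' aP) (m' aLV) (m' aCU) (m' aU0 0)
    < auction_pot N (m aEL) (m aCE 0) L (m aP) (m aLV) (m aCU) (m aU0 0)).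
Proof.
move=> adjP bsN L0 mN mL inv cond.
apply: wp_if => /= u0; last first.
  step; last_step; rewrite addn1.
  by rewrite u0 in inv cond; apply: auction_next => //; lia.
step; apply: wp_if; reads => c0.
  step; apply: wp_if; reads; rewrite addn1 => le_p.
    step; step; step; last_step; rewrite addn1.
    apply: (auction_bid adjP) => //; lia.
  last_step.
  apply: (auction_advance adjP) => //; lia.
step; apply: wp_if; reads; rewrite addn1 => lt_L; last_step.
  apply: (auction_relabel adjP) => //; lia.
apply: (auction_drop adjP) => //; lia.
Qed.

Lemma auction_progP N bs L (m : memory) :
  adjacency_mem N bs m -> bvalid N bs -> 0 < L -> m aNN 0 = N -> m aL 0 = L ->
  wp auction_prog m (N + ((L + 1) * (N + m aCE 0) + N * (L + 1))) (fun m' =>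
    matching N bs (m' aMR) /\
    exists cl cr, vertex_cover bs cl cr /\
      (csize N cl cr - msize N (m' aMR)) * L <= N).
Proof.
move=> adjP bsN L0 mN mL; apply: wp_seq.
pose I x (m1 : memory) := forall i, 0 < i <= x ->
  [/\ m1 aP i = 0, m1 aMR i = 0, m1 aLV i = 0 & m1 aCU i = m aHD i].
apply: (@wp_for _ _ _ I _ 0 _ N) => //; first by rewrite muln1.
- by move=> i; lia.
- move=> x m1 ltx xi _ fr Ix; do 3!step; last_step; rewrite /I; reads.
  rewrite xi !addn1 (fr aHD) // => i ix; rewrite !updE.
  by case: (i =P x.+1) => [->|ne] //; apply: Ix; lia.
move=> m1 fr I1; do 2!step.
have [inv0 pot0] := auction_init adjP bsN L0 I1.
apply: (@wp_while_frame _ _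
  (fun m2 => auction_inv N bs (m aEL) (m aER) (m aCE 0) L
     (m2 aP) (m2 aMR) (m2 aLV) (m2 aCU) (m2 aU 0) (m2 aU0 0))
  (fun m2 => auction_pot N (m aEL) (m aCE 0) L
     (m2 aP) (m2 aLV) (m2 aCU) (m2 aU0 0))).
- by reads.
- by reads.
- move=> m2 fr2 inv2 cond.
  have e a : a \in [:: aEL; aER; aNX; aHD; aCE; aNN; aL] -> m2 a = m a.
    by move=> ia; do ?[case/predU1P: ia => [->|ia]; first by frames].
  have wstep := @auction_stepP N bs L m2.
  rewrite /adjacency_mem (e aEL isT) (e aER isT) (e aNX isT) (e aHD isT)
    (e aCE isT) (e aNN isT) (e aL isT) in wstep.
  case: (wstep adjP bsN L0 mN mL inv2) => [|T [m3 [E le_T [inv3 lt3]]]].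
    by move: cond; rewrite /= (e aNN isT) mN.
  exists 0; first by lia.
  by exists T, m3.
- move=> m2 fr2 [mM pL p0 pm lp cur sc bid u0N fresh dn] cond.
  have e14 : m2 aNN 0 = N by frames.
  move: cond; rewrite /= e14 => cond.
  split=> //; apply: (threshold_cover L0 bsN mM pL p0 _ lp).
    by move=> w wN /(pm w wN)[].
  move=> l lN lL; apply: dn => //; lia.
Qed.

(** Matched left vertices are unmarked by way of their right partners; an unmatched right vertex
    clears cell 0, which stands for no vertex. *)
Definition search_init_prog : prog :=
  Seq (For aI aNN
    (Seq (Write aVIS (Plus1 (Var aI)) (Const 0))
    (Seq (Write aRCH (Plus1 (Var aI)) (Const 1))
    (Seq (Write aVIA (Plus1 (Var aI)) (Const 0))
         (Write aCU (Plus1 (Var aI)) (Read aHD (Plus1 (Var aI))))))))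
  (Seq (For aI aNN (Write aRCH (Read aMR (Plus1 (Var aI))) (Const 0)))
  (Seq (Assign aTOP (Const 0))
  (Seq (Assign aRK (Const 0))
  (Seq (Assign aFND (Const 0))
       (For aI aNN
         (If (Read aRCH (Plus1 (Var aI)))
           (Seq (Assign aTOP (Plus1 (Var aTOP)))
                (Write aSTK (Var aTOP) (Plus1 (Var aI))))
           Skip)))))).

Definition search_step : prog :=
  Seq (Assign aU (Read aSTK (Var aTOP)))
  (Seq (Assign aC (Read aCU (Var aU)))
  (If (Var aC)
    (Seq (Write aCU (Var aU) (Read aNX (Var aC)))
    (Seq (Assign aW (Read aER (Var aC)))
    (If (Read aVIS (Var aW))
      Skip
      (Seq (Assign aRK (Plus1 (Var aRK)))
      (Seq (Write aVIS (Var aW) (Var aRK))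
      (Seq (Write aPAR (Var aW) (Var aU))
      (Seq (Assign aX (Read aMR (Var aW)))
      (If (Var aX)
        (Seq (Assign aTOP (Plus1 (Var aTOP)))
        (Seq (Write aSTK (Var aTOP) (Var aX))
        (Seq (Write aRCH (Var aX) (Const 1))
             (Write aVIA (Var aX) (Var aW)))))
        (Seq (Assign aFND (Var aW)) (Assign aTOP (Const 0)))))))))))
    (Assign aTOP (Minus (Var aTOP) (Const 1))))).

Definition augment_step_prog : prog :=
  Seq (Assign aU (Read aPAR (Var aFND)))
  (Seq (Write aMR (Var aFND) (Var aU))
       (Assign aFND (Read aVIA (Var aU)))).

(** [aGO] remembers whether a free right vertex was found, because the last loop brings [aFND] back
    to 0. *)
Definition phase : prog :=
  Seq search_init_prog
  (Seq (While (Var aTOP) search_step)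
  (Seq (Assign aGO (Var aFND))
       (While (Var aFND) augment_step_prog))).

Definition augmentations : prog :=
  Seq (Assign aGO (Const 1)) (While (Var aGO) phase).

Lemma search_init_progP N bs (m : memory) :
  adjacency_mem N bs m -> m aNN 0 = N -> matching N bs (m aMR) ->
  wp search_init_prog m (N + (N + N)) (fun m' =>
    [/\ search_inv N bs (m aEL) (m aER) (m aHD) (m aCE 0) (m aMR) (m' aVIS)
          (m' aPAR) (m' aRCH) (m' aVIA) (m' aCU) (m' aSTK) (m' aRK 0) (m' aTOP 0),
        search_pot N (m aEL) (m' aVIS) (m' aCU) (m' aTOP 0) <= 3 * N + m aCE 0
      & m' aFND 0 = 0]).
Proof.
move=> adjP mN [mrN _ _]; apply: wp_seq.
pose I1 x (m1 : memory) := forall i, 0 < i <= x ->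
  [/\ m1 aVIS i = 0, m1 aVIA i = 0, m1 aCU i = m aHD i & m1 aRCH i = 1].
apply: (@wp_for _ _ _ I1 _ 0 _ N) => //; first by rewrite muln1.
- by move=> i; lia.
- move=> x m1 ltx xi _ fr Ix; do 3!step; last_step; rewrite /I1; reads.
  rewrite xi !addn1 (fr aHD) // => i ix; rewrite !updE.
  by case: (i =P x.+1) => [->|ne] //; apply: Ix; lia.
move=> m1 fr1 i1; apply: wp_seq.
pose I2 x (m2 : memory) := forall i, 0 < i <= N ->
  m2 aRCH i != 0 <-> forall w, 0 < w <= x -> m aMR w != i.
apply: (@wp_for _ _ _ I2 _ 0 _ N) => //; first by frames.
- by rewrite muln1.
- by move=> i iN; have [_ _ _ ->] := i1 i iN; split=> // _ w; lia.
- move=> x m2 ltx xi _ fr2 Ix; last_step; rewrite /I2; reads => i iN.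
  rewrite xi addn1; have -> : m2 aMR = m aMR by frames.
  rewrite updE; case: (eqVneq i (m aMR x.+1)) => [e|ne].
    by split=> // /(_ x.+1); rewrite leqnn e eqxx => /(_ isT).
  split=> [/(Ix i iN) h w|h].
    by case: (eqVneq w x.+1) => [-> _|wx ?]; [rewrite eq_sym | apply: h; lia].
  by apply/(Ix i iN) => w wx; apply: h; lia.
move=> m2 fr2 i2; do 3!step.
pose I3 x (m3 : memory) := [/\ m3 aTOP 0 <= x,
  forall i, 0 < i <= m3 aTOP 0 -> 0 < m3 aSTK i <= x /\ m2 aRCH (m3 aSTK i) != 0
  & forall u, 0 < u <= x -> m2 aRCH u != 0 ->
    exists2 i, 0 < i <= m3 aTOP 0 & m3 aSTK i = u].
apply: (@wp_for _ _ _ I3 _ 0 _ N) => //; first by frames.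
- by rewrite muln1.
- by rewrite /I3; reads; split=> // i; lia.
- move=> x m3 ltx xi _ fr3 [topx stk opn]; apply: wp_if; reads.
    rewrite xi addn1 => rx; step; last_step; rewrite /I3; reads.
    rewrite xi !addn1; have e : m3 aRCH = m2 aRCH by frames.
    rewrite e in rx; split=> // [i it|u ux ru].
      rewrite updE; case: (i =P _) => [_|ne]; first by rewrite leqnn.
      by have [|? ?] := stk i; [lia | split=> //; lia].
    case: (eqVneq u x.+1) => [->|ne].
      by exists (m3 aTOP 0).+1; rewrite ?upd_same ?leqnn.
    have [|//|i it e'] := opn u; first by lia.
    by exists i; [lia | rewrite upd_other //; lia].
  rewrite xi addn1 => rx; apply: wp_skip; rewrite /I3; reads.
  have e : m3 aRCH = m2 aRCH by frames.
  rewrite e in rx; split=> [|i it|u ux ru]; first by lia.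
    by have [|? ?] := stk i; [lia | split=> //; lia].
  apply: opn => //; case: (eqVneq u x.+1) ru => [->|ne _]; last by lia.
  by rewrite rx.
move=> m3 fr3 [top_le stk opn].
have -> : m3 aFND 0 = 0 by frames.
have -> : m3 aRK 0 = 0 by frames.
have e31 : m3 aRCH = m2 aRCH by frames.
have e30 : m3 aVIA = m1 aVIA by frames.
have e32 : m3 aVIS = m1 aVIS by frames.
have e25 : m3 aCU = m1 aCU by frames.
rewrite e31 e30 e32 e25.
have [|||||] := @search_init N bs _ _ _ _ _ adjP (m aMR) (m1 aVIS) (m3 aPAR)
  (m2 aRCH) (m1 aVIA) (m1 aCU) (m3 aSTK) (m3 aTOP 0) => //.
by move=> i /i1[].
Qed.

Lemma search_stepP N bs (m : memory) :
  adjacency_mem N bs m -> bvalid N bs -> matching N bs (m aMR) ->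
  search_inv N bs (m aEL) (m aER) (m aHD) (m aCE 0) (m aMR) (m aVIS)
    (m aPAR) (m aRCH) (m aVIA) (m aCU) (m aSTK) (m aRK 0) (m aTOP 0) ->
  m aFND 0 = 0 -> m aTOP 0 != 0 ->
  wp search_step m 0 (fun m' =>
    (m' aFND 0 = 0 /\
       search_inv N bs (m aEL) (m aER) (m aHD) (m aCE 0) (m aMR) (m' aVIS)
         (m' aPAR) (m' aRCH) (m' aVIA) (m' aCU) (m' aSTK) (m' aRK 0) (m' aTOP 0)
     \/ m' aTOP 0 = 0 /\
        found_inv N bs (m aMR) (m' aVIS) (m' aPAR) (m' aRCH) (m' aVIA) (m' aRK 0)
          (m' aFND 0)) /\
    search_pot N (m aEL) (m' aVIS) (m' aCU) (m' aTOP 0)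
      < search_pot N (m aEL) (m aVIS) (m aCU) (m aTOP 0)).
Proof.
move=> adjP bsN mrP inv fnd0 top0.
step; step; apply: wp_if; reads => c0; last first.
  last_step; rewrite fnd0 subn1.
  by have [inv' lt] := search_pop inv top0 c0; split=> //; left.
step; step; apply: wp_if; reads => vw.
  apply: wp_skip; reads; rewrite fnd0.
  by have [inv' lt] := search_skip adjP bsN inv top0 c0 vw; split=> //; left.
step; step; step; step; rewrite addn1; apply: wp_if; reads => mw.
  do 3!step; last_step; rewrite fnd0 addn1.
  by have [inv' lt] := search_push adjP bsN mrP inv top0 c0 vw mw;
    split=> //; left.
step; last_step.
by have [inv' lt] := search_found adjP bsN inv top0 c0 vw mw; split=> //; right.
Qed.

(** The potential is the visit time of the vertex being served, which decreases along the path and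
    never exceeds [rk <= N]. *)
Lemma augment_progP N bs mr rch rk w0 (m : memory) :
  trace N bs mr (m aVIS) (m aPAR) rch (m aVIA) rk ->
  augment_inv N bs mr (m aVIS) rch (m aVIA) (m aMR) w0 ->
  m aFND 0 = w0 ->
  wp (While (Var aFND) augment_step_prog) m N (fun m' =>
    matching N bs (m' aMR) /\ msize N (m' aMR) = (msize N mr).+1).
Proof.
move=> trP inv0 fnd.
apply: (@wp_while_frame _ _
  (fun m1 => if m1 aFND 0 == 0
     then matching N bs (m1 aMR) /\ msize N (m1 aMR) = (msize N mr).+1
     else augment_inv N bs mr (m aVIS) rch (m aVIA) (m1 aMR) (m1 aFND 0))
  (fun m1 => if m1 aFND 0 == 0 then 0 else m aVIS (m1 aFND 0))).
- by rewrite fnd; case: eqP (ag_range inv0) => // ->.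
- rewrite fnd; case: eqP => // _.
  have [] := tr_vis trP (ag_range inv0) (ag_vis inv0).
  have := tr_rank trP; lia.
- move=> m1 fr1 /=; case: eqP => // _ inv1 _.
  have v1 := ag_vis inv1; exists 0; first by lia.
  have := augment_step trP inv1 => /= aug.
  have e33 : m1 aPAR = m aPAR by frames.
  have e31 : m1 aVIA = m aVIA by frames.
  step; step; last_step; move: aug; rewrite e33 e31.
  case: eqP => [_ ?|_ [inv2 lt2]]; first by split=> //; rewrite lt0n.
  by split.
- by move=> m1 _ /= h e; rewrite e eqxx in h.
Qed.

Lemma phaseP N bs (m : memory) :
  adjacency_mem N bs m -> bvalid N bs -> m aNN 0 = N -> matching N bs (m aMR) ->
  wp phase m (N + (N + N) + ((3 * N + m aCE 0) + N)) (fun m' =>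
    if m' aGO 0 == 0
    then m' aMR = m aMR /\ exists cl cr,
      vertex_cover bs cl cr /\ csize N cl cr <= msize N (m aMR)
    else matching N bs (m' aMR) /\ msize N (m' aMR) = (msize N (m aMR)).+1).
Proof.
move=> adjP bsN mN mrP; apply: wp_seq.
apply: (wp_weaken (wp_frame (search_init_progP adjP mN mrP))) => // m1.
move=> [[inv1 pot1 fnd1] fr1]; apply: wp_seq.
have e a : a \in [:: aEL; aER; aNX; aHD; aCE; aMR; aNN] -> m1 a = m a.
  by move=> ia; do ?[case/predU1P: ia => [->|ia]; first by frames].
have el := e aEL isT; have er := e aER isT; have nx := e aNX isT.
have hd := e aHD isT; have ce := e aCE isT; have mr := e aMR isT.
pose J (m2 : memory) := m2 aFND 0 = 0 /\
  search_inv N bs (m aEL) (m aER) (m aHD) (m aCE 0) (m aMR) (m2 aVIS)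
    (m2 aPAR) (m2 aRCH) (m2 aVIA) (m2 aCU) (m2 aSTK) (m2 aRK 0) (m2 aTOP 0)
  \/ m2 aTOP 0 = 0 /\ found_inv N bs (m aMR) (m2 aVIS) (m2 aPAR) (m2 aRCH)
       (m2 aVIA) (m2 aRK 0) (m2 aFND 0).
apply: (@wp_while_frame _ _ J
  (fun m2 => search_pot N (m aEL) (m2 aVIS) (m2 aCU) (m2 aTOP 0))) => //.
- by left.
- move=> m2 fr2 [[fnd2 inv2]|[top2 _]] /= top0; last by rewrite top2 in top0.
  exists 0; first by rewrite /search_pot; lia.
  have := @search_stepP N bs m2; rewrite /adjacency_mem.
  have -> : m2 aEL = m aEL by rewrite -el; frames.
  have -> : m2 aER = m aER by rewrite -er; frames.
  have -> : m2 aNX = m aNX by rewrite -nx; frames.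
  have -> : m2 aHD = m aHD by rewrite -hd; frames.
  have -> : m2 aCE = m aCE by rewrite -ce; frames.
  have -> : m2 aMR = m aMR by rewrite -mr; frames.
  by move/(_ adjP bsN mrP inv2 fnd2 top0).
move=> m2 fr2 inv2 /= top2; step.
have e2 : m2 aMR = m aMR by rewrite -mr; frames.
case: inv2 => [[fnd2 inv2]|[_ [tr2 w0N vis0 mr0]]].
  apply: wp_weaken (leq0n _) _; last by move=> m'; exact.
  apply: (@wp_while _ _ (fun m3 => m3 = update m2 aGO 0 (m2 aFND 0)) (fun=> 0))
    => //.
  - by move=> m3 -> /=; reads; rewrite fnd2.
  - move=> m3 -> _; reads; rewrite fnd2 /=; split=> //.
    by rewrite top2 in inv2; apply: (search_failure adjP bsN mrP inv2).
have w := @augment_progP N bs (m aMR) (m2 aRCH) (m2 aRK 0) (m2 aFND 0)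
  (update m2 aGO 0 (m2 aFND 0)).
move: w; reads; rewrite e2 => w.
apply: (wp_weaken (wp_frame (w _ _ _))) => //.
  exact: (augment_init mrP tr2).
move=> m3 [[mM3 sz3] fr3]; have -> : m3 aGO 0 = m2 aFND 0 by frames.
by case: eqP w0N => [->|].
Qed.

(** Weak duality against the given cover allows at most [d] successful phases; one more finds no
    path and returns a cover as certificate. A phase has budget [7 * N] plus the number of edges. *)
Lemma augmentationsP N bs d (m : memory) :
  adjacency_mem N bs m -> bvalid N bs -> m aNN 0 = N -> matching N bs (m aMR) ->
  (exists cl cr, vertex_cover bs cl cr /\ csize N cl cr <= msize N (m aMR) + d) ->
  wp augmentations m (d.+1 * (7 * N + m aCE 0).+1) (fun m' =>
    matching N bs (m' aMR) /\
    exists cl cr, vertex_cover bs cl cr /\ csize N cl cr <= msize N (m' aMR)).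
Proof.
move=> adjP bsN mN mrP [cl [cr [cov le_d]]]; step.
set c := (7 * N + m aCE 0).+1.
pose b := msize N (m aMR) + d.
apply: (@wp_while_frame _ _
  (fun m1 => matching N bs (m1 aMR) /\ (m1 aGO 0 = 0 ->
     exists cl cr, vertex_cover bs cl cr /\ csize N cl cr <= msize N (m1 aMR)))
  (fun m1 => if m1 aGO 0 == 0 then 0 else (b - msize N (m1 aMR)).+1 * c)).
- by reads.
- by reads; rewrite /b addKn.
- move=> m1 fr1 [mr1 _] /= go1; rewrite (negPf go1).
  exists (N + (N + N) + ((3 * N + m aCE 0) + N)); first by rewrite /c; nia.
  have := @phaseP N bs m1; rewrite /adjacency_mem.
  have -> : m1 aEL = m aEL by frames.
  have -> : m1 aER = m aER by frames.
  have -> : m1 aNX = m aNX by frames.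
  have -> : m1 aHD = m aHD by frames.
  have -> : m1 aCE = m aCE by frames.
  have -> : m1 aNN = m aNN by frames.
  move=> /(_ adjP bsN mN mr1) w; apply: (wp_weaken w) => // m2.
  case: eqP => [-> [-> ex]|/eqP go2 [mr2 sz2]].
    by split=> //; rewrite /c; nia.
  split; first by split=> // e; rewrite e in go2.
  have := leq_trans (matching_le_cover mr2 cov) le_d; rewrite -/b sz2 => lt_b.
  have -> : b - msize N (m1 aMR) = (b - msize N (m2 aMR)).+1 by lia.
  rewrite [in X in _ < X]mulSn /c; lia.
- by move=> m1 _ [mr1 ex] /= e; split=> //; apply: ex.
Qed.

(** * Cuts by components *)

Lemma connect_preserves (T : finType) (e : rel T) (Z : T -> Prop) x y :
  (forall x y, e x y -> Z x -> Z y) -> connect e x y -> Z x -> Z y.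
Proof.
move=> cl /connectP[p + ->]; elim: p x => //= z p IH x /andP[xz zp] Zx.
by apply: IH zp _; apply: cl xz Zx.
Qed.

Lemma tsum_add n F : tsum (n + n) F = tsum n F + tsum n (fun i => F (n + i)).
Proof.
rewrite /tsum (big_cat_nat (n := n.+1)) //=; last by lia.
congr addn; rewrite -[n.+1 in LHS]add1n big_addn.
have -> : (n + n).+1 - n = n.+1 by lia.
by apply: eq_bigr => i _; rewrite addnC.
Qed.

Lemma card_ord_tsum n (D : nat -> bool) :
  #|[set b : 'I_n.+1 | (0 < b) && D b]| = tsum n D.
Proof.
rewrite /tsum big_geq_mkord -sum1_card big_mkcond [RHS]big_mkcond /=.
by apply: eq_bigr => i _; rewrite inE; case: (0 < i) => //=; case: (D i).
Qed.

(** On [A] the map [g] factors through [f]; [option] provides a value off the image, as [W] may be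
    empty. *)
Lemma card_imset_factor (T U W : finType) (f : T -> U) (g : T -> W)
    (A : {set T}) :
  {in A &, forall x y, f x = f y -> g x = g y} -> #|g @: A| <= #|f @: A|.
Proof.
move=> fg; rewrite -(card_imset (mem (g @: A)) (fun _ _ => @Some_inj _ _ _)).
pose h b := if [pick x in A | f x == b] is Some x then Some (g x) else None.
suff -> : Some @: (g @: A) = h @: (f @: A) by exact: leq_imset_card.
rewrite -!imset_comp; apply: eq_in_imset => x xA /=; rewrite /h.
case: pickP => [y /andP[yA /eqP fy]|/(_ x)]; last by rewrite xA eqxx.
by congr Some; apply: fg.
Qed.

Lemma induced_connect_sym (V C : finType) (G : colored_graph V C) (A : {set V}) :
  connect_sym (induced G A).
Proof. by apply: sym_connect_sym => x y; rewrite /induced /= adj_sym andbCA. Qed.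

Section Components.
Variables (V C : finType) (G : colored_graph V C) (rep : V -> nat).
Let n := #|V|.

(** Its connected components are those of all the graphs [G[V_i]] taken together. *)
Definition same_color_adj : rel V :=
  [rel u v | adj G u v && (color G u == color G v)].

Definition component_labels :=
  [/\ forall v, 0 < rep v <= n,
      forall u v, rep u = rep v -> connect same_color_adj u v
    & forall u v, same_color_adj u v -> rep u = rep v].

(** The component of [s] or [t] may be selected; it then loses all its nodes but these two, just as
    the colors of [s] and [t] are allowed in a color cut. *)
Definition labelled (D : nat -> bool) (s t : V) : {set V} :=
  [set v | D (rep v)] :\: [set s; t].

Definition label_cut s t (D : nat -> bool) :=
  ~~ connect (induced G (~: labelled D s t)) s t.

(* The left vertex [a] of a label stands for leaving its component and the right
   vertex [a] for entering it; [n + a] is a source, resp. a sink, attached to the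
   neighbors of [s], resp. [t]. *)
Variant flow_edge s t : nat -> nat -> Prop :=
  | FlowLoop a of 0 < a <= n : flow_edge s t a a
  | FlowAdj u v of adj G u v : flow_edge s t (rep u) (rep v)
  | FlowSource v of adj G s v : flow_edge s t (n + rep v) (rep v)
  | FlowSink u of adj G u t : flow_edge s t (rep u) (n + rep u).

Hypothesis repP : component_labels.

Lemma rep_color u v : rep u = rep v -> color G u = color G v.
Proof.
case: repP => _ conn _ /conn.
move/(@connect_preserves _ _ (fun x => color G u = color G x)); apply => //.
by move=> x y /andP[_ /eqP ->].
Qed.

(** * Vertex covers against cuts by labels *)

Section Cuts.
Variables s t : V.
Hypotheses (st : s != t) (nadj : ~~ adj G s t).
Variable bs : seq (nat * nat).
Hypothesis bsP : forall l r, (l, r) \in bs <-> flow_edge s t l r.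

(** The edge [(a, a)] makes each number pay once. A label is selected when it pays again, on its
    other side or at its source or sink, so the cover has at least [n] elements plus one for each
    selected label. *)
Lemma cover_label_cut cl cr : vertex_cover bs cl cr ->
  exists2 D, label_cut s t D & n + tsum n D <= csize (n + n) cl cr.
Proof.
move=> cov; have {}cov l r : flow_edge s t l r -> cl l || cr r.
  by move/bsP; apply: cov.
exists (fun a => [|| cl a && cr a, cl (n + a) | cr (n + a)]); last first.
  rewrite /csize !tsum_add -[X in X + _]muln1 -tsum_const -!tsumD.
  apply: tsum_le => a an; have := cov a a (FlowLoop _ _ an).
  by case: (cl a); case: (cr a); case: (cl _); case: (cr _).
set D := fun a => _.
(* An unselected label is covered on one side only, and being entered forces the right side. [Z] is
   therefore closed along the surviving edges, and it misses [t]. *)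
pose Z v := (v == s) || [&& v != t, ~~ D (rep v) & ~~ cl (rep v)].
apply/negP => /(@connect_preserves _ _ Z) Zt.
suff: Z t by rewrite /Z [t == s]eq_sym (negPf st) eqxx.
apply: Zt; last by rewrite /Z eqxx.
move=> x y /and3P[_ yX xy]; rewrite /Z.
case: (eqVneq y s) => //= ys; case: (eqVneq y t) => [yt|yt] /=.
  (* Non-adjacency excludes the step from [s] straight to [t], which no choice of labels could
     block. *)
  case: (eqVneq x s) => [xs|xs] /=; first by move: nadj; rewrite -xs -yt xy.
  rewrite yt in xy; case/and3P=> _ nD ncl.
  have := cov _ _ (FlowSink s xy); rewrite (negPf ncl) /= => cr_x.
  by move: nD; rewrite /D cr_x !orbT.
have nDy : ~~ D (rep y).
  by move: yX; rewrite /labelled !inE (negPf ys) (negPf yt).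
rewrite nDy /= => Zx; apply: contraNN nDy => cly; rewrite /D cly /=.
case: (eqVneq x s) Zx => [xs _|xs /=].
  by rewrite xs in xy; have := cov _ _ (FlowSource t xy); case: (cl (n + _));
    rewrite ?orbT //= => ->.
case/and3P=> _ _ ncl.
by have := cov _ _ (FlowAdj s t xy); rewrite (negPf ncl) /= => ->.
Qed.

(** Selected labels are covered on both sides, other labels with a node reachable from [s] on the
    right, the remaining numbers on the left, and sources and sinks never. *)
Lemma label_cut_cover D : label_cut s t D ->
  exists cl cr, vertex_cover bs cl cr /\
    csize (n + n) cl cr <= n + tsum n D.
Proof.
case: repP => rN conn mono; rewrite /label_cut => cut.
set e := induced G _ in cut.
pose R a := [exists v, (rep v == a) && connect e s v].
have inX v : ~~ D (rep v) -> v \in ~: labelled D s t.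
  by rewrite /labelled !inE => /negPf ->; rewrite andbF.
have sX : s \in ~: labelled D s t by rewrite /labelled !inE eqxx.
have tX : t \in ~: labelled D s t by rewrite /labelled !inE eqxx orbT.
(* A component that is not selected keeps all its nodes, so it is reached entirely or not at all. *)
have reach u : ~~ D (rep u) -> R (rep u) -> connect e s u.
  move=> nD /existsP[v /andP[/eqP ev sv]]; apply: connect_trans sv _.
  have [] // := @connect_preserves _ _
    (fun x => rep x = rep u /\ connect e v x) v u _ (conn _ _ ev).
  move=> x y xy [ex vx]; have ey := mono _ _ xy; split; first by rewrite -ey.
  apply: connect_trans vx (connect1 _); apply/and3P; split.
  - by apply: inX; rewrite ex.
  - by apply: inX; rewrite -ey ex.
  - by case/andP: xy.
have step u v : connect e s u -> u \in ~: labelled D s t ->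
    v \in ~: labelled D s t -> adj G u v -> connect e s v.
  move=> su uX vX uv; apply: connect_trans su (connect1 _).
  exact/and3P.
have R1 v : connect e s v -> R (rep v).
  by move=> sv; apply/existsP; exists v; rewrite eqxx.
exists (fun l => (l <= n) && (D l || ~~ R l)),
       (fun r => (r <= n) && (D r || R r)); split.
  move=> l r /bsP[a /andP[_ ->]|u v uv|v sv|u ut].
  - by case: (D a); case: (R a).
  - have [/andP[_ ->] /andP[_ ->]] := (rN u, rN v) => /=.
    case Du: (D _) => //=; case Ru: (R (rep u)) => //=.
    case Dv: (D _) => //=; apply: R1; apply: step uv.
    + by apply: reach; rewrite ?Du.
    + by apply: inX; rewrite Du.
    + by apply: inX; rewrite Dv.
  - have /andP[_ ->] := rN v => /=; apply/orP; right.
    case Dv: (D _) => //=; apply: R1; apply: (step s v) => //.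
    by apply: inX; rewrite Dv.
  - have /andP[_ ->] := rN u => /=; apply/orP; left.
    case Du: (D _) => //=; apply: contraNN cut => Ru; apply: step ut => //.
      by apply: reach; rewrite ?Du.
    by apply: inX; rewrite Du.
rewrite /csize !tsum_add -[X in _ <= X + _]muln1 -tsum_const -!tsumD.
apply: tsum_le => a /andP[a0 ->].
have /negPf -> : ~~ (n + a <= n) by rewrite -ltnNge -addn1 leq_add2l.
by case: (D a); case: (R a).
Qed.

End Cuts.

Lemma card_labels (A : {set V}) (D : nat -> bool) :
  (forall a, D a = [exists v in A, rep v == a]) ->
  tsum n D = #|[set (inord (rep v) : 'I_n.+1) | v in A]|.
Proof.
case: repP => rN _ _ DA; rewrite -card_ord_tsum; apply: eq_card => b.
rewrite inE DA; apply/andP/imsetP => [[b0 /exists_inP[v vA /eqP e]]|[v vA ->]].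
  by exists v => //; apply: val_inj; rewrite /= inordK // e.
have /andP[v0 vn] := rN v; rewrite inordK //; split=> //.
by apply/exists_inP; exists v.
Qed.

(** A label determines the color of its component. *)
Lemma labels_colors (A : {set V}) (D : nat -> bool) :
  (forall a, D a = [exists v in A, rep v == a]) -> #|color G @: A| <= tsum n D.
Proof.
move=> /card_labels ->; apply: card_imset_factor => u v uA vA e.
apply: rep_color; case: repP => rN _ _.
have /andP[_ un] := rN u; have /andP[_ vn] := rN v.
by have /(congr1 val) := e; rewrite /= !inordK.
Qed.

Lemma labels_mono (A B : {set V}) : A \subset B ->
  tsum n (fun a => [exists v in A, rep v == a])
  <= tsum n (fun a => [exists v in B, rep v == a]).
Proof.
move=> /subsetP AB; apply: tsum_le => a _.
case: exists_inP => // -[v /AB vB va].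
by case: exists_inP => // -[]; exists v.
Qed.

(** * The factor [q] between components and colors *)

Section Factor.
Variable q : nat.
Hypothesis comp_le : forall i, num_components G (nodes_colored G [set i]) <= q.

(** Labels are constant on the components of [G[V_i]], so each of them occurs at a root, and
    [num_components] counts the roots. *)
Lemma labels_of_color i :
  #|[set (inord (rep v) : 'I_n.+1) | v in nodes_colored G [set i]]| <= q.
Proof.
apply: leq_trans (comp_le i).
set A := nodes_colored G [set i]; set e := induced G A.
have csym : connect_sym e by exact: induced_connect_sym.
pose B := [set v in A | roots e v].
have -> : num_components G A = #|B|.
  by apply: eq_card => v; rewrite !inE andbC.
apply: leq_trans (leq_imset_card (fun v => inord (rep v)) (mem B)).
apply/subset_leq_card/subsetP => _ /imsetP[v vA ->].
have [] : fingraph.root e v \in A /\ rep (fingraph.root e v) = rep v.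
  apply: (@connect_preserves _ e (fun x => x \in A /\ rep x = rep v) v) => //.
    move=> x y /and3P[xA yA xy] [_ <-]; split=> //.
    case: repP => _ _ mono; apply/esym/mono/andP; split=> //.
    by move: xA yA; rewrite !inE => /eqP -> /eqP ->.
  exact: connect_root.
move=> rA <-; apply/imsetP; exists (fingraph.root e v) => //.
by rewrite inE rA roots_root.
Qed.

Lemma labels_of_colors (S : {set C}) :
  tsum n (fun a => [exists v in nodes_colored G S, rep v == a]) <= q * #|S|.
Proof.
rewrite (@card_labels (nodes_colored G S)) // mulnC -sum_nat_const.
pose F i := [set (inord (rep v) : 'I_n.+1) | v in nodes_colored G [set i]].
apply: (@leq_trans (\sum_(i in S) #|F i|)); last first.
  by apply: leq_sum => i _; apply: labels_of_color.
apply: (@leq_trans #|\bigcup_(i in S) F i|).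
  apply/subset_leq_card/subsetP => _ /imsetP[v vS ->].
  rewrite inE in vS; apply/bigcupP; exists (color G v) => //.
  by apply/imsetP; exists v; rewrite // !inE.
elim/big_rec2: _ => [|i k X _ le]; first by rewrite cards0.
by apply: leq_trans (leq_card_setU _ _) _; rewrite leq_add2l.
Qed.

(** This is where the factor [q] is lost: each color of [S] is replaced by all its components, at
    most [q] of them, and together they remove at least the nodes of the given cut. *)
Lemma color_label_cut s t S : color_st_node_cut G s t S ->
  exists2 D, label_cut s t D & tsum n D <= q * #|S|.
Proof.
move=> /existsP[X /andP[XS /andP[Xst cut]]].
exists (fun a => [exists v in nodes_colored G S, rep v == a]).
  apply: contraNN cut; apply: connect_sub => x y /and3P[xX yX xy].
  have sub v : v \in ~: labelled (fun a => [exists v in nodes_colored G S,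
      rep v == a]) s t -> v \in ~: X.
    apply: contraTT; rewrite !inE !negbK => vX.
    have := subsetP Xst v vX; rewrite !inE => -> /=.
    by apply/exists_inP; exists v; rewrite ?eqxx // (subsetP XS).
  by apply: connect1; apply/and3P; split=> //; apply: sub.
exact: labels_of_colors.
Qed.

End Factor.

Lemma label_color_cut s t D : label_cut s t D ->
  exists2 S, color_st_node_cut G s t S & #|S| <= tsum n D.
Proof.
move=> cut; pose A := [set v | D (rep v)].
exists (color G @: A).
  apply/existsP; exists (labelled D s t); apply/and3P; split=> //.
    apply/subsetP => v; rewrite !inE => /andP[_ Dv].
    by apply: imset_f; rewrite inE.
  by apply/subsetP => v; rewrite !inE => /andP[].
apply: leq_trans (labels_colors (A := A) (fun=> erefl)) _.
apply: tsum_le => a _; case: exists_inP => // -[v].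
by rewrite inE => Dv /eqP <-; rewrite Dv.
Qed.

End Components.

(** * Global cuts, approximate minima and edge lists *)

Section GlobalCuts.
Variables (V C : finType) (G : colored_graph V C).

Lemma num_components_gt1 (A : {set V}) :
  reflect (exists s t, [/\ s \in A, t \in A & ~~ connect (induced G A) s t])
          (1 < num_components G A).
Proof.
have csym := induced_connect_sym G A; set e := induced G A in csym *.
have rA v : v \in A -> fingraph.root e v \in A.
  move=> vA; apply: (@connect_preserves _ e (fun x => x \in A) v) => //.
    by move=> x y /and3P[].
  exact: connect_root.
apply: (iffP card_gt1P) => [[x [y [xR yR ne]]]|[s [t [sA tA cut]]]].
  move: xR yR; rewrite !inE => /andP[/eqP rx xA] /andP[/eqP ry yA].
  exists x, y; split=> //; apply: contraNN ne => /(fingraph.rootP csym).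
  by rewrite rx ry => ->.
exists (fingraph.root e s), (fingraph.root e t); split.
- by rewrite !inE roots_root // rA.
- by rewrite !inE roots_root // rA.
- by apply: contraNN cut => /eqP/(fingraph.rootP csym).
Qed.

Lemma color_node_cut_st s t S : color_st_node_cut G s t S -> color_node_cut G S.
Proof.
move=> /existsP[X /andP[XS /andP[/subsetP Xst cut]]].
apply/existsP; exists X; rewrite XS /=; apply/orP; left.
apply/num_components_gt1; exists s, t; split=> //.
  by apply: contraTT isT; rewrite inE negbK => /Xst; rewrite !inE eqxx.
by apply: contraTT isT; rewrite inE negbK => /Xst; rewrite !inE eqxx orbT.
Qed.

Lemma color_node_cut_all v S : [set~ v] \subset nodes_colored G S ->
  color_node_cut G S.
Proof.
move=> sub; apply/existsP; exists [set~ v]; rewrite sub /=; apply/orP; right.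
by rewrite setCK cards1.
Qed.

(** Why two sorts of candidates suffice globally: nodes that a cut leaves in different components
    are non-adjacent and separated by it, while a cut leaving a single node contains all the
    others. *)
Lemma color_node_cutP S : color_node_cut G S ->
  (exists s t, [/\ s != t, ~~ adj G s t & color_st_node_cut G s t S]) \/
  exists v, [set~ v] \subset nodes_colored G S.
Proof.
move=> /existsP[X /andP[XS /orP[/num_components_gt1[s [t [sX tX cut]]]|]]].
  left; exists s, t; split.
  - by apply: contraNN cut => /eqP ->.
  - by apply: contraNN cut => st; apply: connect1; apply/and3P.
  - apply/existsP; exists X; rewrite XS /st_node_cut cut andbT.
    apply/subsetP => v vX; rewrite !inE; apply/norP; split.
      by apply: contraTneq vX => ->; rewrite inE in sX.
    by apply: contraTneq vX => ->; rewrite inE in tX.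
move=> /cards1P[v Xv]; right; exists v; rewrite -Xv setCK; exact: XS.
Qed.

(** The two facts proved about an output [k]: a cut of size at most [k] gives [c <= k], and
    comparing [k] with a minimum cut gives [k <= q * c]. *)
Lemma min_size_approx (P : pred {set C}) k q :
  (exists2 S, P S & #|S| <= k) -> (forall S, P S -> k <= q * #|S|) ->
  exists c, [/\ is_min_size P c, within_factor q c k & q = 1 -> k = c].
Proof.
move=> [S0 PS0 le0] lo.
have ex : exists c, [exists S, P S && (#|S| == c)].
  by exists #|S0|; apply/existsP; exists S0; rewrite PS0 eqxx.
case: (ex_minnP ex) => c /existsP[S /andP[PS /eqP Sc]] minc.
have minP S' : P S' -> c <= #|S'|.
  by move=> PS'; apply: minc; apply/existsP; exists S'; rewrite PS' eqxx.
have wf : within_factor q c k.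
  by rewrite /within_factor (leq_trans (minP _ PS0)) //= -Sc lo.
exists c; split=> //; first by split=> //; exists S.
by move=> q1; move: wf; rewrite q1 /within_factor mul1n => /andP[? ?]; lia.
Qed.

Lemma edge_listE es u v : edge_list G es ->
  adj G u v = ((u, v) \in es) || ((v, u) \in es).
Proof.
move=> esP; have memE := perm_mem esP.
have := memE [set u; v]; rewrite mem_enum => e.
have -> : adj G u v = ([set u; v] \in edges G).
  apply/idP/imsetP => [uv|[[x y] + /setP E]].
    by exists (u, v); rewrite ?inE.
  rewrite inE /= => xy.
  have := E u; have := E v; rewrite !inE !eqxx ?orbT /=.
  move=> /esym/orP[]/eqP ev /esym/orP[]/eqP eu; subst=> //.
  - have := E y; rewrite !inE eqxx orbT orbb => /eqP ey.
    by rewrite ey in xy.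
  - by rewrite adj_sym.
  - have := E x; rewrite !inE eqxx orbb /= => /eqP ex.
    by rewrite ex in xy.
rewrite -e; apply/mapP/orP => [[[x y] xyes /setP E]|[h|h]].
- have := E u; have := E v; rewrite !inE !eqxx ?orbT /=.
  move=> /esym/orP[]/eqP ev /esym/orP[]/eqP eu; subst; auto.
  + have := E y; rewrite !inE eqxx orbT orbb => /eqP ey.
    by rewrite ey in xyes; left.
  + have := E x; rewrite !inE eqxx orbb /= => /eqP ex.
    by rewrite ex in xyes; left.
- by exists (u, v).
- by exists (v, u); rewrite // setUC.
Qed.

Lemma edge_list_size es : edge_list G es -> size es = #|edges G|.
Proof. by move=> /perm_size; rewrite size_map cardE. Qed.

(** The end points of the edges are too few to include every node, so some node is isolated.
    Removing nothing leaves it apart from any other node, or alone if it is the only one. *)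
Lemma sparse_color_node_cut es : edge_list G es -> size es + size es < #|V| ->
  color_node_cut G set0.
Proof.
move=> esP small.
pose ends := [set v in [seq p.1 | p <- es] ++ [seq p.2 | p <- es]].
have [v vN] : exists v, v \notin ends.
  apply/existsP; apply: contraTT small => /existsPn all_in.
  rewrite -leqNgt -cardsT.
  apply: leq_trans (_ : size ([seq p.1 | p <- es] ++ [seq p.2 | p <- es]) <= _).
    apply: leq_trans (card_size _); apply/subset_leq_card/subsetP => v _.
    by have := all_in v; rewrite negbK inE.
  by rewrite size_cat !size_map.
have iso u : ~~ adj G v u.
  rewrite (edge_listE _ _ esP); apply: contraNN vN => /orP[h|h].
    by rewrite inE mem_cat (map_f fst h).
  by rewrite inE mem_cat (map_f snd h) orbT.
have [all_v|[w /negP wv]] : (forall w, w == v) \/ exists w, ~ (w == v).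
  case: (pickP (fun w => w != v)) => [w wv|no]; [right | left].
    by exists w; apply/negP.
  by move=> w; have /negbFE := no w.
  apply: (@color_node_cut_all v); apply/subsetP => w.
  by rewrite !inE (eqP (all_v w)) eqxx.
apply: (@color_node_cut_st v w); apply/existsP; exists set0.
rewrite sub0set /st_node_cut sub0set /=; apply: contraNN wv.
move=> /(@connect_preserves _ _ (fun x => x = v)) h; rewrite h //.
by move=> x y /and3P[_ _ xy] e; move: (iso y); rewrite -e xy.
Qed.

End GlobalCuts.

(** * Computation of the components *)

Notation aA := 40 (only parsing).
Notation aB := 41 (only parsing).

Lemma tsum_recr n F : tsum n.+1 F = tsum n F + F n.+1.
Proof. by rewrite /tsum big_nat_recr. Qed.

Lemma subn_sym_eq0 a b : a - b + (b - a) = 0 -> a = b.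
Proof. lia. Qed.

Section Programs.
Variables (V C : finType) (G : colored_graph V C) (es : seq (V * V)).
Let n := #|V|.
Hypothesis esP : edge_list G es.

Definition node_id (v : V) : nat := enum_rank v.

Lemma node_id_lt v : node_id v < n. Proof. exact: ltn_ord. Qed.
Lemma node_id_inj : injective node_id.
Proof. by move=> u v /val_inj/enum_rank_inj. Qed.
Lemma node_id_onto x : x < n -> exists v, node_id v = x.
Proof. by move=> ltx; exists (enum_val (Ordinal ltx)); rewrite /node_id enum_valK. Qed.

Definition graph_mem (m : memory) :=
  [/\ m aN 0 = n, m aM 0 = size es,
      forall v, m aCol (node_id v) = enum_rank (color G v) :> nat
    & forall p0 j, j < size es -> m aEU j = node_id (nth p0 es j).1 /\
        m aEV j = node_id (nth p0 es j).2].

Definition label_of (f : nat -> nat) (v : V) := f (node_id v).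

Definition merge_step : prog :=
  Seq (Assign aX (Read aEU (Var aJ)))
  (Seq (Assign aY (Read aEV (Var aJ)))
  (If (Neq (Read aCol (Var aX)) (Read aCol (Var aY)))
    Skip
    (Seq (Assign aX (Read aRep (Var aX)))
    (Seq (Assign aY (Read aRep (Var aY)))
    (If (Neq (Var aX) (Var aY))
      (For aI aN
        (If (Neq (Read aRep (Var aI)) (Var aX)) Skip (Write aRep (Var aI) (Var aY))))
      Skip))))).

Definition components_prog : prog :=
  Seq (For aI aN (Write aRep (Var aI) (Plus1 (Var aI))))
  (Seq (Assign aJ (Const 0))
       (While (Minus (Var aM) (Var aJ))
         (Seq merge_step (Assign aJ (Plus1 (Var aJ)))))).

Definition labels_inv (f : nat -> nat) J :=
  [/\ forall v, 0 < label_of f v <= n,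
      forall u v, label_of f u = label_of f v -> connect (same_color_adj G) u v
    & forall p, p \in take J es -> color G p.1 = color G p.2 ->
        label_of f p.1 = label_of f p.2].

(** Summed over [a], this counts the labels in use, which become fewer with each merge. *)
Definition used (f : nat -> nat) a := has (fun x => f x == a) (iota 0 n).

Lemma usedE f a : (exists2 x, x < n & f x = a) -> used f a = true.
Proof.
by move=> [x ltx e]; apply/hasP; exists x; rewrite ?mem_iota //= e eqxx.
Qed.

Lemma labels_done f : labels_inv f (size es) ->
  component_labels G (label_of f).
Proof.
move=> [fN conn mono]; split=> // u v /andP[uv /eqP cuv].
rewrite take_size in mono.
move: uv; rewrite (edge_listE _ _ esP) => /orP[h|h]; first exact: (mono (u, v)).
by apply/esym/(mono (v, u)).
Qed.

Lemma relabel_step f f' J u v : J < size es ->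
  nth (u, v) es J = (u, v) -> color G u = color G v ->
  labels_inv f J -> f (node_id u) != f (node_id v) ->
  (forall x, x < n -> f' x = if f x == f (node_id u) then f (node_id v) else f x) ->
  labels_inv f' J.+1 /\ tsum n (used f') < tsum n (used f).
Proof.
move=> ltJ eJ cuv [fN conn mono] ne f'E; split; last first.
  rewrite -addn1.
  apply: (@tsum_update _ _ _ (label_of f u)) => [|a an au|]; first exact: fN.
    case ua: (used f' a) => //; case/hasP: ua => x.
    rewrite mem_iota => /andP[_ ltx]; rewrite f'E //.
    case: (f x =P _) => [_ /eqP e|_ /eqP e].
      by rewrite usedE //; exists (node_id v); rewrite ?node_id_lt.
    by rewrite usedE //; exists x.
  rewrite [used f _]usedE; last by exists (node_id u); rewrite ?node_id_lt.
  rewrite /used; case ua: (has _ _) => //; case/hasP: ua => x.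
  rewrite mem_iota => /andP[_ ltx]; rewrite f'E // /label_of.
  case: (eqVneq (f x) (f (node_id u))) => [_|/negPf ->] //.
  by rewrite eq_sym (negPf ne).
have lE w : label_of f' w = if label_of f w == label_of f u then label_of f v
                            else label_of f w by rewrite /label_of f'E ?node_id_lt.
have msym : connect_sym (same_color_adj G).
  by apply: sym_connect_sym => x y; rewrite /same_color_adj /= adj_sym eq_sym.
have uv : adj G u v.
  by rewrite (edge_listE _ _ esP) -{1}eJ mem_nth.
have cuv' : connect (same_color_adj G) u v.
  by apply: connect1; apply/andP; rewrite uv cuv.
split.
- by move=> w; rewrite lE; case: eqP.
- move=> x y; rewrite !lE.
  case: eqP => [ex|_]; case: eqP => [ey|_] // e; last exact: conn.
  + by apply: conn; rewrite ex ey.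
  + by apply: connect_trans (conn _ _ ex) (connect_trans cuv' (conn _ _ e)).
  + rewrite msym.
    by apply: connect_trans (conn _ _ ey) (connect_trans cuv' (conn _ _ (esym e))).
- move=> p; rewrite (take_nth (u, v)) // eJ mem_rcons inE.
  case/predU1P=> [-> _ /=|pJ cp]; last by rewrite !lE (mono p pJ cp).
  by rewrite !lE eqxx; case: eqP.
Qed.

(** Amortization: only an edge that joins two labels of one color costs a pass over the nodes, and
    the label that disappears pays for it with its [n] units. For every other edge [j] is 0. *)
Lemma merge_stepP m : graph_mem m -> m aJ 0 < size es ->
  labels_inv (m aRep) (m aJ 0) ->
  exists j, wp merge_step m j (fun m' =>
    labels_inv (m' aRep) (m aJ 0).+1 /\
    j + n * tsum n (used (m' aRep)) <= n * tsum n (used (m aRep))).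
Proof.
move=> [mN mM mC mE] ltJ inv.
have [p0 _] : exists p0, p0 \in es.
  by case: (es) ltJ => // p l _; exists p; rewrite inE eqxx.
case e_uv: (nth p0 es (m aJ 0)) => [u v].
have e_nth : nth (u, v) es (m aJ 0) = (u, v).
  by rewrite -[RHS]e_uv; apply: set_nth_default.
have [eu ev] := mE (u, v) _ ltJ; rewrite e_nth /= in eu ev.
have extend : (color G u = color G v -> label_of (m aRep) u = label_of (m aRep) v)
    -> labels_inv (m aRep) (m aJ 0).+1.
  case: inv => fN conn mono h; split=> // p.
  rewrite (take_nth (u, v)) // e_nth mem_rcons inE => /predU1P[-> //|].
  exact: mono.
have [cuv|cuv] := eqVneq (color G u) (color G v); last first.
  exists 0; step; step; rewrite eu ev; apply: wp_if; reads.
    move=> _; apply: wp_skip; split=> //; apply: extend => e.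
    by rewrite e eqxx in cuv.
  rewrite !mC => e; exfalso; case/negP: cuv; apply/eqP.
  exact/enum_rank_inj/val_inj/subn_sym_eq0.
have [luv|luv] := eqVneq (m aRep (node_id u)) (m aRep (node_id v)).
  exists 0; step; step; rewrite eu ev; apply: wp_if; reads.
    by rewrite !mC cuv subnn.
  move=> _; step; step; apply: wp_if; reads; rewrite luv ?subnn // => _.
  by apply: wp_skip; split=> //; apply: extend.
exists n; step; step; rewrite eu ev; apply: wp_if; reads.
  by rewrite !mC cuv subnn.
move=> _; step; step; apply: wp_if; reads => h; last first.
  by exfalso; case/negP: luv; apply/eqP; lia.
pose I x (m1 : memory) := forall y, m1 aRep y =
  if (y < x) && (m aRep y == m aRep (node_id u)) then m aRep (node_id v) else m aRep y.
apply: (@wp_for _ _ _ I _ 0 _ n) => //; first by rewrite muln1.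
- move=> x m1 ltx xi _ fr Ix.
  have eX : m1 aX 0 = m aRep (node_id u) by frames.
  have eY : m1 aY 0 = m aRep (node_id v) by frames.
  have e_x : m1 aRep x = m aRep x by rewrite Ix ltnn.
  apply: wp_if; rewrite ?eval_Neq; reads; rewrite xi eX e_x => ne.
    apply: wp_skip => y; rewrite Ix [y < x.+1]ltnS [y <= x]leq_eqVlt.
    case: (eqVneq y x) => [->|//]; rewrite ltnn /=.
    by case: eqP ne => // ->; rewrite subnn.
  last_step; rewrite /I; reads => y.
  rewrite xi eY updE Ix [y < x.+1]ltnS [y <= x]leq_eqVlt.
  case: (eqVneq y x) => [->|//] /=; case: eqP => // ne'; exfalso; lia.
move=> m1 fr I1.
have f'E x : x < n -> m1 aRep x =
    if m aRep x == m aRep (node_id u) then m aRep (node_id v) else m aRep x.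
  by move=> ltx; rewrite I1 ltx.
have [inv' lt] := relabel_step ltJ e_nth cuv inv luv f'E.
by split=> //; rewrite -mulnS leq_mul2l lt orbT.
Qed.

Lemma components_progP m : graph_mem m ->
  wp components_prog m (n + (size es + n * n)) (fun m' =>
    component_labels G (label_of (m' aRep))).
Proof.
move=> gm; have [mN mM mC mE] := gm; apply: wp_seq.
pose I x (m1 : memory) := forall y, y < x -> m1 aRep y = y.+1.
apply: (@wp_for _ _ _ I _ 0 _ n) => //; first by rewrite muln1.
- move=> x m1 ltx xi _ fr Ix; last_step; rewrite /I; reads => y.
  rewrite xi addn1 updE; case: (y =P x) => [->|] //; move=> ? ?; apply: Ix; lia.
move=> m1 fr I1; step.
pose J (m2 : memory) := m2 aJ 0 <= size es /\ labels_inv (m2 aRep) (m2 aJ 0).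
apply: (@wp_while_frame _ _ J
  (fun m2 => (size es - m2 aJ 0) + n * tsum n (used (m2 aRep)))).
- split; reads => //; split=> //.
  + by move=> v; rewrite /label_of I1 ?node_id_lt //= node_id_lt.
  + move=> u v; rewrite /label_of !I1 ?node_id_lt // => -[] /node_id_inj ->.
    exact: connect0.
  + by move=> p; rewrite take0.
- reads; rewrite subn0 leq_add2l leq_mul2l; apply/orP; right.
  by rewrite -[leqRHS]muln1; apply: tsum_le_const => i _; case: (used _ _).
- move=> m2 fr2 [leJ inv2] /= ltJ.
  have e4 : m2 aN = m aN by frames.
  have e5 : m2 aM = m aM by frames.
  have e6 : m2 aCol = m aCol by frames.
  have e7 : m2 aEU = m aEU by frames.
  have e8 : m2 aEV = m aEV by frames.
  have gm2 : graph_mem m2 by rewrite /graph_mem e4 e5 e6 e7 e8.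
  rewrite e5 mM in ltJ.
  have [|j w] := merge_stepP gm2 _ inv2; first by lia.
  exists j; first by case: (w) => T [m3 [_ _ [_ le3]]]; lia.
  rewrite -[j]addn0; apply: wp_seq.
  apply: (wp_weaken (wp_frame w)) => // m3 [[inv3 le3] fr3].
  have eJ : m3 aJ = m2 aJ by frames.
  last_step; rewrite eJ addn1 addn0; split; last by lia.
  by split; reads; rewrite ?upd_same; [lia | exact: inv3].
move=> m2 fr2 [leJ inv2] /= cond; apply: labels_done.
have e5 : m2 aM = m aM by frames.
by move: cond inv2; rewrite e5 mM => cond; have -> : m2 aJ 0 = size es by lia.
Qed.

End Programs.

(** * Separating two nodes *)

Definition push_edge : prog :=
  Seq (Assign aCE (Plus1 (Var aCE)))
  (Seq (Write aEL (Var aCE) (Var aA))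
  (Seq (Write aER (Var aCE) (Var aB))
  (Seq (Write aNX (Var aCE) (Read aHD (Var aA)))
       (Write aHD (Var aA) (Var aCE))))).

Definition add_edge (l r : expr) : prog :=
  Seq (Assign aA l) (Seq (Assign aB r) push_edge).

Lemma push_edgeP N bs (m : memory) :
  adjacency_mem N bs m -> 0 < m aA 0 <= N ->
  wp push_edge m 0 (adjacency_mem N (rcons bs (m aA 0, m aB 0))).
Proof.
move=> adjP lN; do 4!step; last_step; rewrite /adjacency_mem; reads.
by rewrite addn1; apply: adjacency_rcons.
Qed.

Lemma add_edgeP N bs (l r : expr) lv rv (m : memory) :
  adjacency_mem N bs m -> eval m l = lv -> eval (update m aA 0 lv) r = rv ->
  0 < lv <= N ->
  wp (add_edge l r) m 0 (adjacency_mem N (rcons bs (lv, rv))).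
Proof.
move=> adjP el er lN; do 2!apply: wp_seq_write; rewrite /= el er.
have w := @push_edgeP N bs (update (update m aA 0 lv) aB 0 rv).
by move: w; rewrite /adjacency_mem; reads => /(_ adjP lN).
Qed.

Lemma add_edge_ifP N bs (a b l r : expr) lv rv (m : memory) :
  adjacency_mem N bs m -> eval m l = lv -> eval (update m aA 0 lv) r = rv ->
  0 < lv <= N ->
  wp (If (Neq a b) Skip (add_edge l r)) m 0 (adjacency_mem N
    (bs ++ (if eval m a == eval m b then [:: (lv, rv)] else [::]))).
Proof.
move=> adjP el er lN; apply: wp_if; rewrite ?eval_Neq => ab.
  by rewrite (negPf ab) cats0; apply: wp_skip.
have -> : eval m a = eval m b by exact: subn_sym_eq0.
by rewrite eqxx cats1; apply: add_edgeP.
Qed.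

Definition half_edge (x y : nat) : prog :=
  Seq (add_edge (Read aRep (Var x)) (Read aRep (Var y)))
  (Seq (If (Neq (Var x) (Var aS))
         Skip
         (add_edge (Add (Var aN) (Read aRep (Var y))) (Read aRep (Var y))))
       (If (Neq (Var y) (Var aT))
         Skip
         (add_edge (Read aRep (Var x)) (Add (Var aN) (Read aRep (Var x)))))).

Definition build_prog : prog :=
  Seq (Assign aNN (Add (Var aN) (Var aN)))
  (Seq (Assign aCE (Const 0))
  (Seq (For aI aNN (Write aHD (Plus1 (Var aI)) (Const 0)))
  (Seq (For aI aN (add_edge (Plus1 (Var aI)) (Plus1 (Var aI))))
       (For aJ aM
         (Seq (Assign aX (Read aEU (Var aJ)))
         (Seq (Assign aY (Read aEV (Var aJ)))
         (Seq (half_edge aX aY) (half_edge aY aX)))))))).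

(** [aSQ] follows the square of [aL] by adding [2 * L + 1], since the machine cannot multiply. *)
Definition sqrt_prog : prog :=
  Seq (Assign aL (Const 0))
  (Seq (Assign aSQ (Const 0))
       (While (Minus (Var aNN) (Var aSQ))
         (Seq (Assign aSQ (Plus1 (Add (Add (Var aSQ) (Var aL)) (Var aL))))
              (Assign aL (Plus1 (Var aL)))))).

Definition count_prog : prog :=
  Seq (Assign aRes (Const 0))
  (Seq (For aI aNN
         (If (Read aMR (Plus1 (Var aI))) (Assign aRes (Plus1 (Var aRes))) Skip))
       (Assign aRes (Minus (Var aRes) (Var aN)))).

Definition st_cut_prog : prog :=
  Seq build_prog
  (Seq sqrt_prog
  (Seq auction_prog
  (Seq augmentations count_prog))).

Lemma ceil_sqrt_ex N : exists L, N <= L * L.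
Proof. by exists N; nia. Qed.

Definition ceil_sqrt N := ex_minn (ceil_sqrt_ex N).

Lemma ceil_sqrt_ge N : N <= ceil_sqrt N * ceil_sqrt N.
Proof. by rewrite /ceil_sqrt; case: ex_minnP. Qed.

Lemma ceil_sqrt_min N x : N <= x * x -> ceil_sqrt N <= x.
Proof. by rewrite /ceil_sqrt; case: ex_minnP => L _ min /min. Qed.

(** By minimality the square of [L - 1] is below [2 * n], and [L <= 2 * (L - 1)] unless [L <= 1].
    The constant 9 is a square, so that [L] is at most three times the root of [n]. *)
Lemma ceil_sqrt_double n : 0 < n ->
  ceil_sqrt (n + n) * ceil_sqrt (n + n) <= 9 * n.
Proof.
move=> n0; set L := ceil_sqrt _.
case: (leqP L 1) => [|L1]; first by nia.
have : ~ (n + n <= L.-1 * L.-1) by move/ceil_sqrt_min; rewrite -/L; lia.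
have -> : L = L.-1.+1 by lia.
by move: (L.-1) => k; nia.
Qed.

Lemma sqrt_progP N (m : memory) : m aNN 0 = N ->
  wp sqrt_prog m N (fun m' => m' aL 0 = ceil_sqrt N).
Proof.
move=> mN; do 2!step.
apply: (@wp_while_frame _ _
  (fun m1 => m1 aL 0 <= ceil_sqrt N /\ m1 aSQ 0 = m1 aL 0 * m1 aL 0)
  (fun m1 => N - m1 aSQ 0)).
- by reads.
- by reads; lia.
- move=> m1 fr1 [leL e] /=; have -> : m1 aNN 0 = N by frames.
  rewrite e => lt_N; exists 0; first by lia.
  step; last_step; rewrite e addn1; split; last by nia.
  split; last by nia.
  rewrite ltnNge; apply/negP => h.
  have := ceil_sqrt_ge N; have : ceil_sqrt N * ceil_sqrt N <= m1 aL 0 * m1 aL 0.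
    exact: leq_mul.
  lia.
- move=> m1 fr1 [leL e] /=; have -> : m1 aNN 0 = N by frames.
  move=> e0; apply/eqP; rewrite eqn_leq leL ceil_sqrt_min //; lia.
Qed.

Lemma count_progP n N (m : memory) : m aN 0 = n -> m aNN 0 = N ->
  wp count_prog m N (fun m' => m' aRes 0 = msize N (m aMR) - n).
Proof.
move=> mn mN; step; rewrite -[N in wp _ _ N]addn0; apply: wp_seq.
pose I x (m1 : memory) := m1 aRes 0 = tsum x (fun w => m aMR w != 0).
apply: (@wp_for _ _ _ I _ 0 _ N) => //.
- by rewrite muln1.
- by rewrite /I; reads; rewrite /tsum big_geq.
- move=> x m1 ltx xi _ fr Ix; have e : m1 aMR = m aMR by frames.
  apply: wp_if; reads; rewrite xi e addn1 => h.
    by last_step; rewrite /I; reads; rewrite Ix tsum_recr h.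
  by apply: wp_skip; rewrite /I tsum_recr h addn0.
move=> m1 fr I1; last_step; have -> : m1 aN 0 = n by frames.
by rewrite I1.
Qed.

(** * The bipartite graph of a pair and its minimum label cut *)

Section StCut.
Variables (V C : finType) (G : colored_graph V C) (es : seq (V * V)).
Variables (s t : V) (f : nat -> nat).
Let n := #|V|.
Let rep := label_of f : V -> nat.
Hypothesis esP : edge_list G es.
Hypothesis repP : component_labels G rep.

Definition half_edges (u v : V) : seq (nat * nat) :=
  (rep u, rep v) :: (if u == s then [:: (n + rep v, rep v)] else [::])
    ++ (if v == t then [:: (rep u, n + rep u)] else [::]).

Definition loops k : seq (nat * nat) := [seq (i.+1, i.+1) | i <- iota 0 k].

Definition flow_edges (es' : seq (V * V)) : seq (nat * nat) :=
  loops n ++ flatten [seq half_edges p.1 p.2 ++ half_edges p.2 p.1 | p <- es'].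

Lemma mem_half_edges u v l r : (l, r) \in half_edges u v <->
  [\/ l = rep u /\ r = rep v, [/\ u = s, l = n + rep v & r = rep v]
    | [/\ v = t, l = rep u & r = n + rep u]].
Proof.
rewrite inE mem_cat; split.
  case/orP=> [/eqP[-> ->]|/orP[]]; first by constructor 1.
    by case: eqP => // -> ; rewrite inE => /eqP[-> ->]; constructor 2.
  by case: eqP => // -> ; rewrite inE => /eqP[-> ->]; constructor 3.
case=> [[-> ->]|[-> -> ->]|[-> -> ->]]; first by rewrite eqxx.
  by rewrite eqxx inE eqxx orbT.
by rewrite eqxx inE eqxx !orbT.
Qed.

Lemma mem_flow_edges l r : (l, r) \in flow_edges es <-> flow_edge G rep s t l r.
Proof.
have aE u v := edge_listE u v esP.
have half u v : adj G u v -> (l, r) \in half_edges u v -> flow_edge G rep s t l r.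
  move=> uv /mem_half_edges[[-> ->]|[us -> ->]|[vt -> ->]].
  - by apply: FlowAdj uv.
  - by apply: FlowSource; rewrite -us.
  - by apply: FlowSink; rewrite -vt.
have half' u v e : adj G u v -> e \in half_edges u v -> e \in flow_edges es.
  rewrite mem_cat aE => /orP[h|h] lr; apply/orP; right; apply/flattenP.
    exists (half_edges u v ++ half_edges v u); last by rewrite mem_cat lr.
    by apply/mapP; exists (u, v).
  exists (half_edges v u ++ half_edges u v); last by rewrite mem_cat lr orbT.
  by apply/mapP; exists (v, u).
split.
  rewrite mem_cat => /orP[/mapP[i]|/flattenP[_ /mapP[[u v] uv ->]]].
    by rewrite mem_iota => ltn [-> ->]; apply: FlowLoop.
  rewrite mem_cat /= => /orP[]; apply: half; rewrite aE uv ?orbT //.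
case=> [a /andP[a0 an]|u v uv|v sv|u ut].
- rewrite mem_cat; apply/orP; left; apply/mapP; exists a.-1; last by case: a a0 an.
  by rewrite mem_iota; case: a a0 an.
- by apply: (half' _ _ _ uv); apply/mem_half_edges; constructor 1.
- by apply: (half' _ _ _ sv); apply/mem_half_edges; constructor 2.
- by apply: (half' _ _ _ ut); apply/mem_half_edges; constructor 3.
Qed.

Lemma flow_edges_valid : bvalid (n + n) (flow_edges es).
Proof.
have [rN _ _] := repP; move=> l r /mem_flow_edges[a an|u v _|v _|u _].
- by split; lia.
- by have := rN u; have := rN v; rewrite -/n => ? ?; split; lia.
- by have := rN v; rewrite -/n => ?; split; lia.
- by have := rN u; rewrite -/n => ?; split; lia.
Qed.

(** Each of the two orientations of an edge contributes at most three pairs. *)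
Lemma size_flow_edges : size (flow_edges es) <= n + 6 * size es.
Proof.
rewrite size_cat size_map size_iota leq_add2l.
elim: es => //= p es' IH; rewrite !size_cat /= !size_cat.
by do 4?[case: eqP => _] => /=; lia.
Qed.

Definition st_mem (m : memory) :=
  [/\ m aRep = f, m aN 0 = n, m aS 0 = node_id s & m aT 0 = node_id t].

Lemma half_edgeP x y u v bs (m : memory) :
  (x = aX /\ y = aY) \/ (x = aY /\ y = aX) ->
  st_mem m -> m x 0 = node_id u -> m y 0 = node_id v ->
  adjacency_mem (n + n) bs m ->
  wp (half_edge x y) m 0 (adjacency_mem (n + n) (bs ++ half_edges u v)).
Proof.
have [rN _ _] := repP; rewrite -/n in rN.
have ru := rN u; have rv := rN v.
move=> xy [mR mN mS mT] mx my adjP.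
have node_idE (w z : V) : (node_id w == node_id z) = (w == z).
  by rewrite (inj_eq (@node_id_inj V)).
have -> : bs ++ half_edges u v = (rcons bs (rep u, rep v)
    ++ (if node_id u == node_id s then [:: (n + rep v, rep v)] else [::]))
    ++ (if node_id v == node_id t then [:: (rep u, n + rep u)] else [::]).
  by rewrite !node_idE /half_edges -cat1s !catA cats1.
rewrite -mS -mT -mx -my.
case: xy => -[ex ey]; subst x y; apply: (@wp_seq _ _ _ 0 0).
all: apply: (wp_weaken (wp_frame (add_edgeP (lv := rep u) (rv := rep v)
       adjP _ _ _))) => //; try by [reads; rewrite ?mx ?my ?mR | lia].
all: move=> m1 [adj1 fr1]; apply: (@wp_seq _ _ _ 0 0).
all: have e1 : m1 aN 0 = n by frames.
all: have e2 : m1 aS = m aS by frames.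
all: have e3 : m1 aT = m aT by frames.
all: have e4 : m1 aRep = f by frames.
all: have e5 : m1 aX = m aX by frames.
all: have e6 : m1 aY = m aY by frames.
all: apply: (wp_weaken (wp_frame (add_edge_ifP (Var _) (Var aS)
       (lv := n + rep v) (rv := rep v) adj1 _ _ _))) => //;
  try by [reads; rewrite ?e1 ?e4 ?e5 ?e6 ?mx ?my | lia].
all: move=> m2 [adj2 fr2]; rewrite /= ?e2 ?e5 ?e6 in adj2.
all: have e1' : m2 aN 0 = n by frames.
all: have e3' : m2 aT = m aT by frames.
all: have e4' : m2 aRep = f by frames.
all: have e5' : m2 aX = m aX by frames.
all: have e6' : m2 aY = m aY by frames.
all: rewrite -e3'.
1: rewrite -[in X in _ ++ (if X then _ else _)]e6'.
2: rewrite -[in X in _ ++ (if X then _ else _)]e5'.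
all: apply: (add_edge_ifP (Var _) (Var aT) (lv := rep u) (rv := n + rep u) adj2)
  => //; by [reads; rewrite ?e1' ?e4' ?e5' ?e6' ?mx ?my | lia].
Qed.

Lemma build_progP (m : memory) : graph_mem G es m -> st_mem m ->
  wp build_prog m (n + n + (n + size es)) (fun m' =>
    adjacency_mem (n + n) (flow_edges es) m' /\ m' aNN 0 = n + n).
Proof.
move=> [mN mM _ mE] [mR _ mS mT]; step; step; apply: wp_seq; rewrite mN.
pose I1 x (m1 : memory) := forall i, 0 < i <= x -> m1 aHD i = 0.
apply: (@wp_for _ _ _ I1 _ 0 _ (n + n)) => //; first by rewrite muln1.
- by move=> i; lia.
- move=> x m1 ltx xi _ _ Ix; last_step; rewrite /I1; reads => i ix.
  rewrite xi addn1 updE; case: eqP => // ne; apply: Ix; lia.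
move=> m1 fr1 hd0; apply: wp_seq.
have e15 : m1 aCE 0 = 0 by frames.
pose I2 x := adjacency_mem (n + n) (loops x).
apply: (@wp_for _ _ _ I2 _ 0 _ n) => //; first by frames.
- by rewrite muln1.
- by rewrite /I2 /adjacency_mem e15; apply: adjacency0.
- move=> x m2 ltx xi _ fr2 Ix.
  have -> : I2 x.+1 = adjacency_mem (n + n) (rcons (loops x) (x.+1, x.+1)).
    by rewrite /I2 /loops -[X in iota _ X]addn1 iotaD map_cat cats1.
  by apply: add_edgeP => //; reads; rewrite ?xi ?addn1 //; lia.
move=> m2 fr2 adj2.
pose I3 J := adjacency_mem (n + n) (flow_edges (take J es)).
apply: (@wp_for _ _ _ I3 _ 0 _ (size es)) => //; first by frames.
- by rewrite muln1.
- by rewrite /I3 take0 /flow_edges cats0.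
- move=> J m3 ltJ eJ _ fr3 adj3.
  have [p0 _] : exists p0, p0 \in es.
    by case: (es) ltJ => // p l _; exists p; rewrite inE eqxx.
  case e_uv: (nth p0 es J) => [u v].
  have [eu ev] := mE p0 _ ltJ; rewrite e_uv /= in eu ev.
  have e7 : m3 aEU = m aEU by frames.
  have e8 : m3 aEV = m aEV by frames.
  step; step; rewrite eJ e7 e8 eu ev.
  set m4 := update _ aY 0 _.
  have st4 : st_mem m4 by rewrite /m4; split; frames.
  apply: (@wp_seq _ _ _ 0 0).
  apply: (wp_weaken (wp_frame (half_edgeP (u := u) (v := v) (m := m4) _ st4 _ _
    adj3))) => //; try by [left | rewrite /m4; reads].
  move=> m5 [adj5 fr5].
  have -> : I3 J.+1 = adjacency_mem (n + n)
      ((flow_edges (take J es) ++ half_edges u v) ++ half_edges v u).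
    by rewrite /I3 (take_nth p0) // e_uv /flow_edges map_rcons flatten_rcons !catA.
  apply: half_edgeP adj5; first by right.
  + by split; frames; rewrite /m4; frames.
  + by frames; rewrite /m4; frames.
  + by frames; rewrite /m4; frames.
move=> m3 fr3; rewrite /I3 take_size => adj3; split=> //.
by frames.
Qed.

(** With [2 * k] vertices on each side and at most [k + 6 * e] edges, the budgets of all loops sum
    to at most [L.+1 * (29 * k + 13 * e + 1)], where [L] is the rounded root. *)
Definition st_cost k e := 30 * ((ceil_sqrt (k + k)).+1 * (k + e).+1).

Lemma st_cut_progP (m : memory) : graph_mem G es m -> st_mem m ->
  wp st_cut_prog m (st_cost n (size es)) (fun m' =>
    (s != t -> ~~ adj G s t ->
      exists2 D, label_cut G rep s t D & tsum n D <= m' aRes 0) /\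
    (forall D, label_cut G rep s t D -> m' aRes 0 <= tsum n D)).
Proof.
move=> gm stm; have [mN _ _ _] := gm.
have n0 : 0 < n by apply/card_gt0P; exists s.
set N := n + n; set ce := size (flow_edges es); set L := ceil_sqrt N.
have L0 : 0 < L by have := ceil_sqrt_ge N; rewrite -/L; case: (L) => //; lia.
have bsN := flow_edges_valid; rewrite -/N in bsN.
apply: (@wp_weaken _ _ (n + n + (n + size es) + (N + (N +
  ((L + 1) * (N + ce) + N * (L + 1)) + (L.+1 * (7 * N + ce).+1 + N)))) _ _ _ _ _
  (fun _ h => h)); last first.
  have := size_flow_edges; rewrite -/ce /st_cost -/L /N => le_ce.
  have : (L + 1) * (n + n + ce) <= L.+1 * (3 * n + 6 * size es).
    by rewrite addn1 leq_mul2l; lia.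
  have : L.+1 * (7 * (n + n) + ce).+1 <= L.+1 * (15 * n + 6 * size es + 1).
    by rewrite leq_mul2l; lia.
  nia.
apply: wp_seq; apply: (wp_weaken (wp_frame (build_progP gm stm))) => //.
move=> m1 [[adj1 NN1] fr1].
apply: wp_seq; apply: (wp_weaken (wp_frame (sqrt_progP NN1))) => //.
move=> m2 [L2 fr2]; rewrite -/N -/L in L2.
have adj2 : adjacency_mem N (flow_edges es) m2.
  rewrite /adjacency_mem.
  have -> : m2 aEL = m1 aEL by frames. have -> : m2 aER = m1 aER by frames.
  have -> : m2 aNX = m1 aNX by frames. have -> : m2 aHD = m1 aHD by frames.
  by have -> : m2 aCE = m1 aCE by frames.
have ce2 : m2 aCE 0 = ce by case: adj2.
have NN2 : m2 aNN 0 = N by frames.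
apply: wp_seq; have w := auction_progP adj2 bsN L0 NN2 L2; rewrite ce2 in w.
apply: (wp_weaken (wp_frame w)) => // m3 [[mr3 [cl [cr [cov3 le3]]]] fr3] {w}.
have adj3 : adjacency_mem N (flow_edges es) m3.
  rewrite /adjacency_mem.
  have -> : m3 aEL = m2 aEL by frames. have -> : m3 aER = m2 aER by frames.
  have -> : m3 aNX = m2 aNX by frames. have -> : m3 aHD = m2 aHD by frames.
  by have -> : m3 aCE = m2 aCE by frames.
have ce3 : m3 aCE 0 = ce by case: adj3.
have NN3 : m3 aNN 0 = N by rewrite -NN2; frames.
have ex3 : exists cl cr, vertex_cover (flow_edges es) cl cr /\
    csize N cl cr <= msize N (m3 aMR) + L.
  (* The gap times [L] is at most [N <= L * L], so at most [L] augmentations are missing. *)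
  exists cl, cr; split=> //; rewrite -leq_subLR -(leq_pmul2r L0).
  exact: leq_trans le3 (ceil_sqrt_ge N).
apply: wp_seq; have w := augmentationsP adj3 bsN NN3 mr3 ex3; rewrite ce3 in w.
apply: (wp_weaken (wp_frame w)) => // m4 [[mr4 [cl4 [cr4 [cov4 le4]]]] fr4] {w}.
have NN4 : m4 aNN 0 = N by rewrite -NN3; frames.
have n4 : m4 aN 0 = n by frames.
apply: (wp_weaken (count_progP n4 NN4)) => // m5 ->.
split=> [st nadj|D cut].
  have [D cut le_D] := cover_label_cut st nadj mem_flow_edges cov4.
  by exists D => //; rewrite -/n -/N in le_D; lia.
have [cl' [cr' [cov' le']]] := label_cut_cover repP mem_flow_edges cut.
have := matching_le_cover mr4 cov'; rewrite -/n -/N in le' *; lia.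
Qed.

End StCut.

(** * The two algorithms *)

Notation aBest := 42 (only parsing).
Notation aBad := 43 (only parsing).
Notation aMark := 44 (only parsing).

Definition copy_prog (off : nat) : prog :=
  Seq (Assign aN (Read aIn (Const off)))
  (Seq (Assign aM (Read aIn (Const off.+1)))
  (Seq (For aI aN (Write aCol (Var aI) (Read aIn (Add (Const off.+2) (Var aI)))))
  (Seq (Assign aX (Add (Const off.+2) (Var aN)))
       (For aJ aM
         (Seq (Write aEU (Var aJ) (Read aIn (Var aX)))
         (Seq (Write aEV (Var aJ) (Read aIn (Plus1 (Var aX))))
              (Assign aX (Add (Var aX) (Const 2))))))))).

Definition st_main : prog :=
  Seq (Assign aS (Read aIn (Const 0)))
  (Seq (Assign aT (Read aIn (Const 1)))
  (Seq (copy_prog 2)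
  (Seq components_prog
  (Seq st_cut_prog (Assign aOut (Var aRes)))))).

Definition update_best : prog :=
  If (Minus (Var aBest) (Var aRes)) (Assign aBest (Var aRes)) Skip.

(** Here [aS] is the one node that would remain; the labels of the others are counted, each being
    marked when first met. *)
Definition cover_count_prog : prog :=
  Seq (For aI aN (Write aMark (Plus1 (Var aI)) (Const 0)))
  (Seq (Assign aRes (Const 0))
       (For aI aN
         (If (Neq (Var aI) (Var aS))
           (Seq (Assign aX (Read aRep (Var aI)))
           (If (Read aMark (Var aX))
             Skip
             (Seq (Write aMark (Var aX) (Const 1))
                  (Assign aRes (Plus1 (Var aRes))))))
           Skip))).

Definition adjacent_prog : prog :=
  Seq (Assign aBad (Const 0))
  (Seq (If (Neq (Var aS) (Var aT)) Skip (Assign aBad (Const 1)))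
       (For aJ aM
         (Seq (If (Add (Neq (Read aEU (Var aJ)) (Var aS))
                       (Neq (Read aEV (Var aJ)) (Var aT)))
                Skip (Assign aBad (Const 1)))
              (If (Add (Neq (Read aEU (Var aJ)) (Var aT))
                       (Neq (Read aEV (Var aJ)) (Var aS)))
                Skip (Assign aBad (Const 1)))))).

Definition best_for_t : prog :=
  Seq adjacent_prog (If (Var aBad) Skip (Seq st_cut_prog update_best)).

Definition best_for_s : prog :=
  Seq cover_count_prog (Seq update_best (For aT aN best_for_t)).

Definition global_main : prog :=
  Seq (Assign aN (Read aIn (Const 0)))
  (Seq (Assign aM (Read aIn (Const 1)))
  (If (Minus (Var aN) (Add (Var aM) (Var aM)))
    (Assign aOut (Const 0))
    (Seq (copy_prog 0)
    (Seq components_prog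
    (Seq (Assign aBest (Var aN))
    (Seq (For aS aN best_for_s)
         (Assign aOut (Var aBest)))))))).

Lemma nth_flatten_pairs (T : Type) (a b : T -> nat) (r : seq T) p0 j :
  j < size r ->
  let r2 := flatten [seq [:: a p; b p] | p <- r] in
  nth 0 r2 (j + j) = a (nth p0 r j) /\ nth 0 r2 (j + j).+1 = b (nth p0 r j).
Proof. by elim: r j => // p r IH [|j] //= /IH; rewrite addnS. Qed.

Section Main.
Variables (V C : finType) (G : colored_graph V C) (es : seq (V * V)).
Let n := #|V|.
Hypothesis esP : edge_list G es.

Lemma copy_progP (pre : seq nat) (m : memory) :
  m aIn = nth 0 (pre ++ graph_input G es) ->
  wp (copy_prog (size pre)) m (n + size es) (graph_mem G es).
Proof.
move=> m_in.
have inE0 i : m aIn (size pre + i) = nth 0 (graph_input G es) i.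
  by rewrite m_in nth_cat ltnNge leq_addr /= addKn.
have inN : m aIn (size pre) = n by rewrite -[size pre]addn0 inE0.
have inM : m aIn (size pre).+1 = size es by rewrite -addn1 inE0.
have inC v : m aIn ((size pre).+2 + node_id v) = enum_rank (color G v).
  rewrite -addn2 -addnA add2n inE0 /graph_input /= nth_cat size_map -cardE.
  rewrite node_id_lt (nth_map v) ?nth_enum_rank //.
  by rewrite -cardE node_id_lt.
have inE p0 j : j < size es ->
    m aIn ((size pre).+2 + n + (j + j)) = node_id (nth p0 es j).1 /\
    m aIn ((size pre).+2 + n + (j + j)).+1 = node_id (nth p0 es j).2.
  move=> ltj; have inF i : m aIn ((size pre).+2 + n + i) =
      nth 0 (flatten [seq [:: node_id p.1; node_id p.2] | p <- es]) i.
    have -> : (size pre).+2 + n + i = size pre + (n + i).+2 by lia.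
    rewrite inE0 /graph_input /= nth_cat size_map -cardE.
    by rewrite ltnNge leq_addr /= addKn.
  by rewrite -addnS !inF; apply: nth_flatten_pairs.
rewrite /copy_prog; step; step; apply: wp_seq; rewrite inN inM.
pose I x (m1 : memory) := forall v, node_id v < x ->
  m1 aCol (node_id v) = enum_rank (color G v).
apply: (@wp_for _ _ _ I _ 0 _ n) => //; first by rewrite muln1.
- move=> x m1 ltx xi _ fr Ix; last_step; rewrite /I; reads => v.
  have -> : m1 aIn = m aIn by frames.
  rewrite xi updE; case: (node_id v =P x) => [<- _|ne lt_v]; first exact: inC.
  by apply: Ix; lia.
move=> m1 fr1 col; step.
have -> : m1 aN 0 = n by frames.
pose J x (m2 : memory) := m2 aX 0 = (size pre).+2 + n + (x + x) /\
  forall p0 j, j < x -> m2 aEU j = node_id (nth p0 es j).1 /\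
    m2 aEV j = node_id (nth p0 es j).2.
apply: (@wp_for _ _ _ J _ 0 _ (size es)) => //; first by frames.
- by rewrite muln1.
- by split; reads; rewrite ?addn0.
- move=> x m2 ltx xi _ fr2 [eX ex]; step; step; last_step; split; reads.
    by rewrite eX; lia.
  have -> : m2 aIn = m aIn by frames.
  move=> p0 j ltj; rewrite eX xi addn1 !updE.
  case: (eqVneq j x) => [->|ne]; first exact: inE.
  by apply: ex; lia.
move=> m2 fr2 [_ ex]; split=> //; try by frames.
have -> : m2 aCol = m1 aCol by frames.
by move=> v; apply: col; apply: node_id_lt.
Qed.

Lemma st_mainP (s t : V) k q :
  (forall i : C, num_components G (nodes_colored G [set i]) <= q) ->
  s != t -> ~~ adj G s t ->
  n + size es + (n + (size es + n * n) + st_cost n (size es)) = k ->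
  wp st_main (initial_memory (st_graph_input G s t es)) k (fun m =>
    exists c, [/\ is_min_size (color_st_node_cut G s t) c,
      within_factor q c (m aOut 0) & q = 1 -> m aOut 0 = c]).
Proof.
move=> qP st nadj <-; set m0 := initial_memory _.
rewrite /st_main; step; step; apply: wp_seq.
set m1 := update _ aT 0 _.
have w1 := @copy_progP [:: node_id s; node_id t] m1 erefl.
apply: (wp_weaken (wp_frame w1)) => // m2 [gm2 fr2].
apply: wp_seq; apply: (wp_weaken (wp_frame (components_progP esP gm2))) => //.
move=> m3 [rep3 fr3]; have [mN mM mC mE] := gm2.
have gm3 : graph_mem G es m3.
  rewrite /graph_mem.
  have -> : m3 aN = m2 aN by frames. have -> : m3 aM = m2 aM by frames.
  have -> : m3 aCol = m2 aCol by frames. have -> : m3 aEU = m2 aEU by frames.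
  by have -> : m3 aEV = m2 aEV by frames.
have st3 : st_mem s t (m3 aRep) m3.
  by split=> //; rewrite /m1; frames; rewrite /m1; frames.
rewrite -[X in wp _ _ X]addn0; apply: wp_seq.
apply: (wp_weaken (st_cut_progP esP rep3 gm3 st3)) => // m4 [ach lo].
last_step; apply: min_size_approx => [|S].
  have [D cut le_D] := ach st nadj.
  have [S cS le_S] := label_color_cut rep3 cut; exists S => //.
  exact: leq_trans le_S le_D.
by case/(color_label_cut rep3 qP) => D cut le_D; apply: leq_trans (lo D cut) le_D.
Qed.

(** * The running minimum over all candidates *)

Section Best.
Variable f : nat -> nat.
Let rep := label_of f : V -> nat.
Hypothesis repP : component_labels G rep.

Definition others (s : V) (a : nat) := [exists v in [set~ s], rep v == a].

Lemma cover_count_progP (s : V) (m : memory) :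
  m aN 0 = n -> m aRep = f -> m aS 0 = node_id s ->
  wp cover_count_prog m (n + n) (fun m' => m' aRes 0 = tsum n (others s)).
Proof.
move=> mN mR mS; have [rN _ _] := repP; apply: wp_seq.
pose I1 x (m1 : memory) := forall i, 0 < i <= x -> m1 aMark i = 0.
apply: (@wp_for _ _ _ I1 _ 0 _ n) => //; first by rewrite muln1.
- by move=> i; lia.
- move=> x m1 ltx xi _ _ Ix; last_step; rewrite /I1; reads => i ix.
  rewrite xi addn1 updE; case: eqP => // ne; apply: Ix; lia.
move=> m1 fr1 mark0; step.
pose seen x a := [exists v in [set~ s], (node_id v < x) && (rep v == a)].
pose I2 x (m2 : memory) := (forall a, 0 < a <= n -> (m2 aMark a != 0) = seen x a)
  /\ m2 aRes 0 = tsum n (seen x).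
have seenS v a :
    seen (node_id v).+1 a = seen (node_id v) a || (v != s) && (rep v == a).
  apply/exists_inP/orP => [[w ws /andP[lt_w wa]]|].
    case: (eqVneq w v) => [<-|wv]; first by right; rewrite wa andbT -in_setC1.
    left; apply/exists_inP; exists w; rewrite // wa andbT.
    have : node_id w != node_id v by rewrite (inj_eq (@node_id_inj V)).
    by lia.
  case=> [/exists_inP[w ws /andP[lt_w wa]]|/andP[vs va]].
    by exists w; rewrite // wa andbT ltnW.
  by exists v; rewrite ?in_setC1 // ltnS leqnn.
apply: (@wp_for _ _ _ I2 _ 0 _ n) => //; first by frames.
- by rewrite muln1.
- have seen0 a : seen 0 a = false by apply/exists_inP => -[].
  split; reads; first by move=> a an; rewrite mark0 // seen0.
  by rewrite (@tsum_eq _ _ (fun=> 0)) ?tsum_const ?muln0 // => a _; rewrite seen0.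
- move=> x m2 ltx xi _ fr2 [mark cnt].
  have [v ev] := node_id_onto ltx.
  have eS : m2 aS 0 = node_id s by frames.
  have eR : m2 aRep = f by frames.
  have rv : f x = rep v by rewrite /rep /label_of ev.
  apply: wp_if; rewrite ?eval_Neq; reads; rewrite xi eS -ev; last first.
    move/subn_sym_eq0/node_id_inj => vs; apply: wp_skip.
    split=> [a an|]; first by rewrite seenS vs eqxx /= -vs ev mark ?orbF.
    by rewrite cnt -ev; apply: tsum_eq => a _; rewrite seenS vs eqxx orbF.
  move=> ne; have vs : v != s.
    by apply: contraNneq ne => ->.
  step; rewrite xi eR rv; apply: wp_if; reads => seen_v.
    apply: wp_skip; have sv : seen x (rep v) by rewrite -mark.
    have sE a : seen x.+1 a = seen x a.
      by rewrite -ev seenS vs /=; case: eqP => [<-|]; rewrite ev ?orbF // sv.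
    split=> [a an|]; reads; rewrite ?ev ?sE ?mark //.
    by rewrite cnt; apply: tsum_eq => a _; rewrite sE.
  step; last_step; have sv : seen x (rep v) = false by rewrite -mark // seen_v.
  split=> [a an|]; reads.
    rewrite seenS ev vs updE [rep v == a]eq_sym.
    by case: (a =P rep v); rewrite ?orbT ?orbF // mark.
  rewrite cnt addn1 ev (tsum_split (seen x) (rN v)) sv add0n.
  rewrite [RHS](tsum_split _ (rN v)) -ev seenS vs eqxx orbT add1n; congr _.+1.
  apply: tsum_eq => a _; rewrite seenS vs /=.
  by case: (eqVneq a (rep v)) => // _; rewrite orbF.
move=> m2 fr2 [_ ->]; apply: tsum_eq => a _; congr nat_of_bool.
by apply: eq_existsb => v; rewrite node_id_lt.
Qed.

Lemma wp_flag e (m : memory) :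
  wp (If e Skip (Assign aBad (Const 1))) m 0 (fun m' =>
    (m' aBad 0 != 0) = (m aBad 0 != 0) || (eval m e == 0)).
Proof.
apply: wp_if => e0; first by rewrite (negPf e0) orbF; apply: wp_skip.
by rewrite e0 eqxx orbT; last_step.
Qed.

Lemma adjacent_progP (s t : V) (m : memory) :
  graph_mem G es m -> m aS 0 = node_id s -> m aT 0 = node_id t ->
  wp adjacent_prog m (size es) (fun m' =>
    (m' aBad 0 != 0) = (s == t) || adj G s t).
Proof.
move=> [mN mM _ mE] mS mT; step; rewrite -[size es]add0n; apply: wp_seq.
apply: (wp_weaken (wp_frame (wp_flag _ _))) => // m1 [bad1 fr1].
have {}bad1 : (m1 aBad 0 != 0) = (s == t).
  rewrite bad1; reads; rewrite mS mT -(inj_eq (@node_id_inj V)); lia.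
pose hit (p : V * V) := (p == (s, t)) || (p == (t, s)).
pose I x (m2 : memory) := (m2 aBad 0 != 0) = (s == t) || has hit (take x es).
apply: (@wp_for _ _ _ I _ 0 _ (size es)) => //; first by frames.
- by rewrite muln1.
- by rewrite /I take0 orbF.
- move=> x m2 ltx xi _ fr2 Ix.
  have [p0 _] : exists p0, p0 \in es.
    by case: (es) ltx => // p l _; exists p; rewrite inE eqxx.
  rewrite /I (take_nth p0) // has_rcons.
  have [eu ev] := mE p0 _ ltx; case: (nth _ _ _) eu ev => u v /= eu ev.
  have e7 : m2 aEU x = node_id u by frames.
  have e8 : m2 aEV x = node_id v by frames.
  have eS : m2 aS 0 = node_id s by frames.
  have eT : m2 aT 0 = node_id t by frames.
  have pairE (a b : V) : (node_id u - node_id a + (node_id a - node_id u)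
     + (node_id v - node_id b + (node_id b - node_id v)) == 0) = ((u, v) == (a, b)).
    by rewrite xpair_eqE -!(inj_eq (@node_id_inj V)); lia.
  apply: (@wp_seq _ _ _ 0 0).
  apply: (wp_weaken (wp_frame (wp_flag _ _))) => // m3 [bad3 fr3].
  apply: (wp_weaken (wp_flag _ _)) => // m4 ->.
  rewrite bad3 Ix /=; have -> : m3 aEU = m2 aEU by frames.
  have -> : m3 aEV = m2 aEV by frames. have -> : m3 aS = m2 aS by frames.
  have -> : m3 aT = m2 aT by frames. have -> : m3 aJ = m2 aJ by frames.
  rewrite xi e7 e8 eS eT !pairE -!orbA; congr orb.
  by rewrite orbC -!orbA.
move=> m2 _ ->; rewrite take_size (edge_listE s t esP); congr orb.
apply/hasP/orP => [[p pes /orP[]/eqP e]|[h|h]].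
- by left; rewrite -e.
- by right; rewrite -e.
- by exists (s, t); rewrite // /hit eqxx.
- by exists (t, s); rewrite // /hit eqxx orbT.
Qed.

Definition attained b :=
  exists2 S, color_node_cut G S & #|S| <= b.

Lemma attained_others s : attained (tsum n (others s)).
Proof.
exists (color G @: [set~ s]); last exact: (labels_colors repP (fun=> erefl)).
by apply: (@color_node_cut_all _ _ _ s); apply/subsetP => v vs; rewrite inE imset_f.
Qed.

Lemma update_bestP (m : memory) : attained (m aBest 0) -> attained (m aRes 0) ->
  wp update_best m 0 (fun m' =>
    [/\ attained (m' aBest 0), m' aBest 0 <= m aBest 0
      & m' aBest 0 <= m aRes 0]).
Proof.
move=> a1 a2; apply: wp_if => /= h; first by last_step; split=> //; lia.
by apply: wp_skip; split=> //; lia.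
Qed.

(** The lower half of the approximation for one pair, [attained] being the upper half. It persists
    when the running minimum [b] decreases. *)
Definition settled b s t := s != t -> ~~ adj G s t ->
  forall D, label_cut G rep s t D -> b <= tsum n D.

Definition best_mem (m : memory) := graph_mem G es m /\ m aRep = f.

Lemma best_for_tP (s t : V) (m : memory) :
  best_mem m -> m aS 0 = node_id s -> m aT 0 = node_id t ->
  attained (m aBest 0) ->
  wp best_for_t m (size es + st_cost n (size es)) (fun m' =>
    [/\ attained (m' aBest 0), m' aBest 0 <= m aBest 0 & settled (m' aBest 0) s t]).
Proof.
move=> [gm mR] mS mT att; apply: wp_seq.
apply: (wp_weaken (wp_frame (adjacent_progP gm mS mT))) => // m1 [bad fr1].
have e42 : m1 aBest = m aBest by frames.
apply: wp_if => /= hb.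
  apply: wp_skip; rewrite e42; split=> // st nadj.
  by move: hb; rewrite bad (negPf st) (negPf nadj).
move: bad; rewrite hb => /esym/negbT; rewrite negb_or => /andP[st nadj].
have gm1 : graph_mem G es m1.
  rewrite /graph_mem.
  have -> : m1 aN = m aN by frames. have -> : m1 aM = m aM by frames.
  have -> : m1 aCol = m aCol by frames. have -> : m1 aEU = m aEU by frames.
  by have -> : m1 aEV = m aEV by frames.
have st1 : st_mem s t f m1 by case: gm => mN _ _ _; split; frames.
rewrite -[X in wp _ _ X]addn0; apply: wp_seq.
apply: (wp_weaken (wp_frame (st_cut_progP esP repP gm1 st1))) => // m2.
move=> [[ach lo] fr2]; have e42' : m2 aBest = m aBest by rewrite -e42; frames.
have att2 : attained (m2 aRes 0).
  have [D cut le_D] := ach st nadj; have [S cS le_S] := label_color_cut repP cut.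
  by exists S; [exact: color_node_cut_st cS | exact: leq_trans le_S le_D].
rewrite -e42' in att.
apply: (wp_weaken (update_bestP att att2)) => // m3 [att3 le1 le2].
split=> //; first by rewrite -e42'.
by move=> _ _ D cut; apply: leq_trans le2 (lo D cut).
Qed.

Lemma best_for_sP (s : V) (m : memory) :
  best_mem m -> m aS 0 = node_id s -> attained (m aBest 0) ->
  wp best_for_s m (n + n + n * (size es + st_cost n (size es)).+1) (fun m' =>
    [/\ attained (m' aBest 0), m' aBest 0 <= m aBest 0,
        m' aBest 0 <= tsum n (others s) & forall t, settled (m' aBest 0) s t]).
Proof.
move=> [gm mR] mS att; have [mN mM mC mE] := gm; apply: wp_seq.
apply: (wp_weaken (wp_frame (cover_count_progP mN mR mS))) => // m1 [res1 fr1].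
have e42 : m1 aBest = m aBest by frames.
rewrite -[X in wp _ _ X]add0n; apply: wp_seq.
rewrite -e42 in att; have att1 : attained (m1 aRes 0).
  by rewrite res1; apply: attained_others.
apply: (wp_weaken (wp_frame (update_bestP att att1))) => // m2.
move=> [[att2 le1 le2] fr2]; rewrite res1 in le2; rewrite e42 in le1.
pose I x (m3 : memory) := [/\ attained (m3 aBest 0), m3 aBest 0 <= m2 aBest 0
  & forall t, node_id t < x -> settled (m3 aBest 0) s t].
apply: (@wp_for _ _ _ I _ (size es + st_cost n (size es)) _ n) => //.
- by frames.
- move=> x m3 ltx xi _ fr3 [att3 le3 set3].
  have [t et] := node_id_onto ltx.
  have bm3 : best_mem m3.
    split; last by frames.
    by split; frames.
  have mS3 : m3 aS 0 = node_id s by frames.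
  rewrite -et in xi.
  apply: (wp_weaken (best_for_tP bm3 mS3 xi att3)) => // m4 [att4 le4 set4].
  split=> //; first exact: leq_trans le4 le3.
  move=> t'; rewrite ltnS leq_eqVlt => /orP[|lt_t'].
    by rewrite -et (inj_eq (@node_id_inj V)) => /eqP ->.
  by move=> st' nadj' D cut; apply: leq_trans le4 (set3 t' lt_t' st' nadj' D cut).
move=> m3 fr3 [att3 le3 set3]; split=> //.
- exact: leq_trans le3 le1.
- exact: leq_trans le3 le2.
- by move=> t; apply: set3; apply: node_id_lt.
Qed.

End Best.

Definition global_cost k e :=
  k + e + (k + (e + k * k) + k * (k + k + k * (e + st_cost k e).+1).+1).

Lemma global_mainP q :
  (forall i : C, num_components G (nodes_colored G [set i]) <= q) -> 0 < n ->
  wp global_main (initial_memory (graph_input G es))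
    (if size es + size es < n then 0 else global_cost n (size es)) (fun m =>
    exists c, [/\ is_min_size (color_node_cut G) c,
      within_factor q c (m aOut 0) & q = 1 -> m aOut 0 = c]).
Proof.
move=> qP n0; set m0 := initial_memory _.
rewrite /global_main; step; step; apply: wp_if; reads => small.
  have lt_e : size es + size es < n by rewrite -subn_gt0 lt0n; exact: small.
  rewrite lt_e; last_step.
  apply: min_size_approx => //.
  by exists set0; rewrite ?cards0 //; apply: sparse_color_node_cut esP lt_e.
have -> : (size es + size es < n) = false.
  by apply/negbTE; rewrite -leqNgt -subn_eq0; apply/eqP; exact: small.
set m1 := update _ aM 0 _; apply: wp_seq.
apply: (wp_weaken (wp_frame (@copy_progP [::] m1 erefl))) => // m2 [gm2 fr2].
apply: wp_seq; apply: (wp_weaken (wp_frame (components_progP esP gm2))) => //.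
move=> m3 [rep3 fr3]; have [mN mM mC mE] := gm2.
step; have -> : m3 aN 0 = n by frames.
set m4 := update _ aBest 0 _.
have [s0 _] : exists s0 : V, s0 \in V by apply/card_gt0P.
(* The initial value [n] already bounds a genuine cut, which leaves only [s0], since there are at
   most [n] labels. *)
have att4 : attained (m4 aBest 0).
  rewrite /m4; reads; have [S cS le_S] := attained_others rep3 s0.
  exists S => //; apply: leq_trans le_S _; rewrite -[leqRHS]muln1.
  by apply: tsum_le_const => a _; case: (others _ _ _).
pose lo b s := b <= tsum n (others (m3 aRep) s) /\
  forall t, settled (m3 aRep) b s t.
pose I x (m5 : memory) := attained (m5 aBest 0) /\
  forall s, node_id s < x -> lo (m5 aBest 0) s.
rewrite -[X in wp _ _ X]addn0; apply: wp_seq.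
apply: (@wp_for _ _ _ I _ (n + n + n * (size es + st_cost n (size es)).+1) _ n)
  => //.
- by rewrite /m4; frames.
- move=> x m5 ltx xi _ fr5 [att5 lo5]; have [s es_x] := node_id_onto ltx.
  have bm5 : best_mem (m3 aRep) m5.
    by split; [split; frames; rewrite /m4; frames | frames; rewrite /m4; frames].
  rewrite -es_x in xi *.
  apply: (wp_weaken (best_for_sP rep3 bm5 xi att5)) => // m6 [att6 le6 oth6 set6].
  split=> // s'; rewrite ltnS leq_eqVlt => /orP[|lt_s'].
    by rewrite (inj_eq (@node_id_inj V)) => /eqP ->.
  rewrite es_x in lt_s'; have [oth5 set5] := lo5 s' lt_s'.
  split; first exact: leq_trans le6 oth5.
  by move=> t st nadj D cut; apply: leq_trans le6 (set5 t st nadj D cut).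
move=> m5 fr5 [att5 lo5]; last_step; apply: min_size_approx => // S cS.
have {}lo5 s := lo5 s (node_id_lt s).
case: (color_node_cutP cS) => [[s [t [st nadj cutS]]]|[v sub]].
  have [D cut le_D] := color_label_cut rep3 qP cutS.
  by have [_ set5] := lo5 s; apply: leq_trans le_D; apply: set5 cut.
have [oth5 _] := lo5 v; apply: leq_trans oth5 _.
apply: leq_trans (labels_mono (label_of (m3 aRep)) sub) _.
exact: labels_of_colors.
Qed.

End Main.

(** * Running times *)

Lemma ceil_sqrt_gt0 N : 0 < N -> 0 < ceil_sqrt N.
Proof. by have := ceil_sqrt_ge N; case: (ceil_sqrt N) => //; lia. Qed.

(** The cut computations give [30 * 8 * X], by [L.+1 <= 2 * L] and [k + e + 1 <= 4 * e]; the other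
    terms give at most [10 * X], and the final unit one more. *)
Lemma global_cost_le k e : 0 < k -> k <= e + e ->
  (global_cost k e).+1 <= 251 * (k * k * ceil_sqrt (k + k) * e).
Proof.
move=> k0 le_k; have : 0 < ceil_sqrt (k + k) by apply: ceil_sqrt_gt0; lia.
rewrite /global_cost /st_cost; move: (ceil_sqrt _) => L L0.
set X := k * k * L * e.
have e0 : 0 < e by lia.
have hk : k * k <= X by rewrite /X -mulnA leq_pmulr // muln_gt0 L0.
have h1 : k <= k * k by rewrite leq_pmulr.
have he : e <= X by rewrite /X leq_pmull // !muln_gt0 k0 L0.
have hke : k * k * e <= X by rewrite /X leq_mul2r leq_pmulr ?orbT.
have hst : k * k * (L.+1 * (k + e).+1) <= k * k * ((2 * L) * (4 * e)).
  by rewrite leq_mul2l; apply/orP; right; apply: leq_mul; lia.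
have eX : k * k * ((2 * L) * (4 * e)) = 8 * X by rewrite /X; lia.
rewrite eX in hst; move: (_ * (k + e).+1) X {eX} hk he hke hst => Y X hk he hke hst.
lia.
Qed.

Lemma st_total_le k e : 0 < k ->
  (k + e + (k + (e + k * k) + st_cost k e)).+1
  <= 4 * (k * k) + 2 * e + 60 * (ceil_sqrt (k + k) * (2 * k + e)).
Proof.
move=> k0; have : 0 < ceil_sqrt (k + k) by apply: ceil_sqrt_gt0; lia.
rewrite /st_cost; move: (ceil_sqrt _) => L L0.
have : L.+1 * (k + e).+1 <= (2 * L) * (2 * k + e) by apply: leq_mul; lia.
nia.
Qed.

(** * Comparison with the bounds over the reals *)

Section RealBounds.
Import Order.TTheory GRing.Theory Num.Theory.
Local Open Scope ring_scope.
Variables (R : rcfType) (k e : nat).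
Hypothesis k0 : (0 < k)%N.
Let s : R := Num.sqrt k%:R.

Lemma sqrt_nat_bounds : [/\ 1 <= s, s <= k%:R & s * s = k%:R].
Proof.
have ss : s * s = k%:R by rewrite -expr2 sqr_sqrtr // ler0n.
have s1 : 1 <= s by rewrite -[1]sqrtr1 ler_wsqrtr // ler1n.
by split=> //; rewrite -ss ler_peMr // (le_trans ler01).
Qed.

Lemma ceil_sqrt_le : (ceil_sqrt (k + k))%:R <= 3 * s.
Proof.
have [s1 _ ss] := sqrt_nat_bounds.
rewrite -ler_sqr ?nnegrE ?ler0n //; last by rewrite mulr_ge0 // (le_trans ler01).
rewrite exprMn [s ^+ 2]expr2 ss -natrX -[3 ^+ 2]natrX -natrM ler_nat.
by rewrite -mulnn ceil_sqrt_double.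
Qed.

(** [L <= 3 * s] turns [60 * L * (2 * k + e)] into [360 * s * k + 180 * s * e]; then
    [s * k <= k ^ 2] explains 364 as 4 + 360. *)
Lemma st_time_le :
  (k + e + (k + (e + k * k) + st_cost k e)).+1%:R
  <= 364 * (s * e%:R + k%:R ^+ 2) :> R.
Proof.
have [s1 sk ss] := sqrt_nat_bounds; have Ls := ceil_sqrt_le.
apply: le_trans (_ : (4 * (k * k) + 2 * e + 60 * (ceil_sqrt (k + k) * (2 * k + e)))%:R
  <= _); first by rewrite ler_nat st_total_le.
rewrite !(natrD, natrM) expr2.
have e0 : 0 <= e%:R :> R by rewrite ler0n.
set L := (ceil_sqrt _)%:R in Ls *; set x := k%:R in ss sk *.
set y := e%:R in e0 *.
have h : L * (2 * x + y) <= 3 * s * (2 * x + y).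
  by rewrite ler_wpM2r //; lra.
have h1 : s * x <= x * x by rewrite ler_wpM2r //; lra.
have h2 : 1 * y <= s * y by rewrite ler_wpM2r.
lra.
Qed.

(** 753 is 3 times 251, the 3 coming from [L <= 3 * s]. The summand 1 pays for the sparse case,
    where [e] may be 0. *)
Lemma global_time_le :
  (if (e + e < k)%N then 0%N else global_cost k e).+1%:R
  <= 753 * (k%:R ^+ 2 * s * e%:R + 1) :> R.
Proof.
have b0 : 0 <= k%:R ^+ 2 * s * e%:R :> R.
  by rewrite !mulr_ge0 ?exprn_ge0 ?sqrtr_ge0 ?ler0n.
case: ltnP => [_|le_k]; first by lra.
have Ls := ceil_sqrt_le; rewrite mulrDr.
apply: le_trans (_ : 753 * (k%:R ^+ 2 * s * e%:R) <= _); last by lra.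
apply: le_trans (_ : (251 * (k * k * ceil_sqrt (k + k) * e))%:R <= _).
  by rewrite ler_nat global_cost_le.
rewrite !natrM expr2.
have h : k%:R * k%:R * (ceil_sqrt (k + k))%:R * e%:R
      <= k%:R * k%:R * (3 * s) * e%:R :> R.
  by rewrite ler_wpM2r ?ler0n // ler_wpM2l // mulr_ge0 ?ler0n.
lra.
Qed.

End RealBounds.

Lemma time_scale (R : rcfType) (T P k c : nat) (b : R) :
  T <= P * k -> (k%:R <= c%:R * b -> T%:R <= (P * c)%:R * b)%R.
Proof.
rewrite -(Num.Theory.ler_nat R) => le_T le_k; apply: Order.POrderTheory.le_trans le_T _.
by rewrite !GRing.natrM -GRing.mulrA Num.Theory.ler_wpM2l // Num.Theory.ler0n.
Qed.

Theorem theorem4 (R : rcfType) :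
  (exists (p : prog) (K : nat),
     forall (V C : finType) (G : colored_graph V C) (q : nat),
       (forall i : C, num_components G (nodes_colored G [set i]) <= q) ->
     forall s t : V, s != t -> ~~ adj G s t ->
     forall es : seq (V * V), edge_list G es ->
     exists A T c : nat,
       [/\ outputs_in_time p (st_graph_input G s t es) A T,
           (T%:R <= K%:R * (Num.sqrt #|V|%:R * #|edges G|%:R + #|V|%:R ^+ 2)
             :> R)%R,
           is_min_size (color_st_node_cut G s t) c,
           within_factor q c A
         & q = 1 -> A = c])
  /\
  (exists (p : prog) (K : nat),
     forall (V C : finType) (G : colored_graph V C) (q : nat),
       (forall i : C, num_components G (nodes_colored G [set i]) <= q) ->
       0 < #|V| ->
     forall es : seq (V * V), edge_list G es ->
     exists A T c : nat,
       [/\ outputs_in_time p (graph_input G es) A T,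
           (T%:R <= K%:R * (#|V|%:R ^+ 2 * Num.sqrt #|V|%:R * #|edges G|%:R + 1)
             :> R)%R,
           is_min_size (color_node_cut G) c,
           within_factor q c A
         & q = 1 -> A = c]).
Proof.
split.
  (* The constant is the size of the program times the bound for its loop budget. *)
  exists st_main, (psize st_main * 364) => V C G q qP s t st nadj es esP.
  have [T [m [ex le_T [c [min wf q1]]]]] := st_mainP esP qP st nadj erefl.
  exists (m 1 0), T, c; split=> //; first by exists m.
  have V0 : 0 < #|V| by apply/card_gt0P; exists s.
  by rewrite -(edge_list_size esP); apply: time_scale le_T (st_time_le R _ V0).
exists global_main, (psize global_main * 753) => V C G q qP V0 es esP.
have [T [m [ex le_T [c [min wf q1]]]]] := global_mainP esP qP V0.
exists (m 1 0), T, c; split=> //; first by exists m.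
by rewrite -(edge_list_size esP); apply: time_scale le_T (global_time_le R _ V0).
Qed.
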